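(* Let $(\omega,c)\in\mathbb{R}^2$ satisfy: $\omega>c^2/4$, or $\omega=c^2/4$ and $c>0$. For $L>L_0(\omega,c)$ let $\Phi^L_{\omega,c}$ be the function on $[-L,L]$ defined below. Then for every integer $m\ge 0$, $$\lim_{L\to\infty}\bigl\|\Phi^L_{\omega,c}-\Phi_{\omega,c}\bigr\|_{H^m([-L,L])}=0.$$
   Context: Set $\alpha_0=\tfrac13(4c+\sqrt{48\omega+4c^2})$, $\alpha_1=4\sqrt\omega+2c$, $A(x)=-3x^2+8cx+64\omega$, $L_0(\omega,c)=2\pi/\sqrt{\alpha_0\sqrt{A(\alpha_0)}}$. For $\eta_3\in(\alpha_0,\alpha_1)$ put $\eta_1=\frac{-\eta_3+4c-\sqrt{A(\eta_3)}}{2}$, $\eta_2=\frac{-\eta_3+4c+\sqrt{A(\eta_3)}}{2}$ (one has $\eta_1<0<\eta_2<\eta_3$), $k^2=\frac{-\eta_1(\eta_3-\eta_2)}{\eta_3(\eta_2-\eta_1)}\in(0,1)$, $g=\frac{2}{\sqrt{\eta_3(\eta_2-\eta_1)}}$, $\beta^2=-\eta_3k^2/\eta_1$, and $T(\eta_3)=4gK(k)$, where $K(k)=\int_0^{\pi/2}(1-k^2\sin^2\theta)^{-1/2}d\theta$. The map $\eta_3\mapsto T(\eta_3)$ is a strictly increasing bijection of $(\alpha_0,\alpha_1)$ onto $(2L_0,\infty)$; for $L>L_0$ let $\eta_3$ be the unique value with $T(\eta_3)=2L$, and define the positive function $\Phi^L_{\omega,c}$ on $[-L,L]$ by $(\Phi^L_{\omega,c}(x))^2=\eta_3\,\mathrm{dn}^2(\frac{x}{2g};k)/(1+\beta^2\mathrm{sn}^2(\frac{x}{2g};k))$,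 with $\mathrm{sn},\mathrm{dn}$ the Jacobi elliptic functions of modulus $k$. (It is a $2L$-periodic solution of $-\Phi''+(\omega-\frac{c^2}4)\Phi+\frac c2\Phi^3-\frac3{16}\Phi^5=0$.) $\Phi_{\omega,c}$ is the function on $\mathbb{R}$ with $\Phi_{\omega,c}>0$ and $\Phi_{\omega,c}^2(x)=\frac{4\omega-c^2}{\sqrt\omega(\cosh(\sqrt{4\omega-c^2}x)-\frac{c}{2\sqrt\omega})}$ if $\omega>c^2/4$, $\Phi_{\omega,c}^2(x)=\frac{4c}{(cx)^2+1}$ if $\omega=c^2/4,\ c>0$. $H^m([-L,L])$ is the standard Sobolev space on the interval. *)

(* Defs.v *)
From Stdlib Require Import Reals Lra ClassicalEpsilon.
From Coquelicot Require Import Coquelicot.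
Open Scope R_scope.

Definition ellF (k2 phi : R) : R :=
  RInt (fun t => / sqrt (1 - k2 * (sin t) ^ 2)) 0 phi.

Definition ellK (k2 : R) : R := ellF k2 (PI / 2).

(** Jacobi amplitude: the (unique, for 0 <= k^2 < 1) phi with F(phi;k) = u. *)
Definition jac_am (k2 u : R) : R :=
  epsilon (inhabits 0) (fun phi => ellF k2 phi = u).

Definition jac_sn (k2 u : R) : R := sin (jac_am k2 u).
Definition jac_dn (k2 u : R) : R := sqrt (1 - k2 * (jac_sn k2 u) ^ 2).

Section Periodic.
Variables omega c : R.

Definition alpha0 : R := (4 * c + sqrt (48 * omega + 4 * c ^ 2)) / 3.
Definition alpha1 : R := 4 * sqrt omega + 2 * c.
Definition polyA (x : R) : R := - 3 * x ^ 2 + 8 * c * x + 64 * omega.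
Definition L0 : R := 2 * PI / sqrt (alpha0 * sqrt (polyA alpha0)).

Definition eta1 (e3 : R) : R := (- e3 + 4 * c - sqrt (polyA e3)) / 2.
Definition eta2 (e3 : R) : R := (- e3 + 4 * c + sqrt (polyA e3)) / 2.
Definition modk2 (e3 : R) : R :=
  (- eta1 e3 * (e3 - eta2 e3)) / (e3 * (eta2 e3 - eta1 e3)).
Definition gfun (e3 : R) : R := 2 / sqrt (e3 * (eta2 e3 - eta1 e3)).
Definition beta2 (e3 : R) : R := - e3 * modk2 e3 / eta1 e3.
Definition Tper (e3 : R) : R := 4 * gfun e3 * ellK (modk2 e3).

(** For L > L0, the unique eta3 in (alpha0, alpha1) with T(eta3) = 2L. *)
Definition eta3_of (L : R) : R :=
  epsilon (inhabits 0)
    (fun e3 => alpha0 < e3 < alpha1 /\ Tper e3 = 2 * L).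

Definition PhiL (L x : R) : R :=
  let e3 := eta3_of L in
  let k2 := modk2 e3 in
  let u := x / (2 * gfun e3) in
  sqrt (e3 * (jac_dn k2 u) ^ 2 / (1 + beta2 e3 * (jac_sn k2 u) ^ 2)).

Definition Phi (x : R) : R :=
  if Rlt_dec (c ^ 2 / 4) omega then
    sqrt ((4 * omega - c ^ 2) /
          (sqrt omega * (cosh (sqrt (4 * omega - c ^ 2) * x) - c / (2 * sqrt omega))))
  else sqrt (4 * c / ((c * x) ^ 2 + 1)).

End Periodic.

Definition Hm_norm (m : nat) (L : R) (f : R -> R) : R :=
  sqrt (sum_f_R0 (fun j => RInt (fun x => (Derive_n f j x) ^ 2) (- L) L) m).

(* Main.v *)
Require Import Defs.
From Stdlib Require Import Reals.
From Coquelicot Require Import Coquelicot.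
From Stdlib Require Import Lra Psatz Ranalysis5 ClassicalEpsilon FunctionalExtensionality.
Open Scope R_scope.

(** Both profiles are positive even solutions, decreasing away from [0], of the same equation
    [u'' = force u], with energy [u'^2 = energy u + E] and [E <= 0] ([E = eta1 eta2 eta3 / 16]
    for the periodic wave, [E = 0] for the soliton).  Every derivative of such a solution is a
    fixed polynomial in [(u, u')], hence Lipschitz on bounded sets, so [H^m] convergence reduces
    to [H^1].  On a fixed interval [[0, R]] the two solutions are close by Gronwall, because the
    initial values [sqrt eta3] and [sqrt alpha1] are; beyond [R] one has [|u'| <= C u] and the
    integral of [u^2] is bounded by [C u(R)], uniformly in the period, since [u'] (if
    [omega > c^2/4]) or [u'/u] (if [omega = c^2/4]) is a monotone quantity whose derivative
    dominates [u^2].  Finally [T(eta3)^2 (alpha1 - eta3)] is bounded, so [eta3] tends to [alpha1];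
    values of [eta3] with [T(eta3) = 2L] exist because [T] is continuous and unbounded. *)

(** * Elliptic integrals and the Jacobi amplitude *)

(** The closed formula for [PhiL] is a poor guide to the limit, because it degenerates in two
    different ways: if [omega > c^2/4] the modulus tends to 1 and [K] blows up, while if
    [omega = c^2/4] the squared modulus tends to 1/2 and [g] and [beta2] blow up. The formula
    therefore serves only to extract a few facts (the profile equation with its energy, the values
    at 0 and at the half period, the sign of the derivative), and the comparison uses nothing else,
    so it treats both cases at once. The interval grows with [L] and a Gronwall factor is
    exponential in its length, so the cut between core and tail has to be fixed from the soliton
    alone, before [L] is chosen. Smallness of the periodic wave at the cut is then inherited from
    the soliton by Gronwall, and the tail constants must depend neither on [L] nor on the energy
    level. *)

Lemma sin_sqr_bound (t : R) : 0 <= sin t ^ 2 <= 1.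
Proof.
generalize (sin2_cos2 t); unfold Rsqr; intros H; split; nra.
Qed.

Lemma ell_radicand_pos (k2 t : R) : 0 <= k2 < 1 -> 0 < 1 - k2 * sin t ^ 2.
Proof. intros Hk; generalize (sin_sqr_bound t); nra. Qed.

Definition ell_integrand (k2 t : R) : R := / sqrt (1 - k2 * sin t ^ 2).

Lemma ell_integrand_continuous (k2 t : R) : 0 <= k2 < 1 -> continuous (ell_integrand k2) t.
Proof.
intros Hk; apply (ex_derive_continuous (ell_integrand k2)).
unfold ell_integrand; auto_derive.
assert (H := ell_radicand_pos k2 t Hk); simpl in H.
split; [exact H|split; [|exact I]].
apply Rgt_not_eq, sqrt_lt_R0, H.
Qed.

Lemma ell_integrand_ex_RInt (k2 x y : R) : 0 <= k2 < 1 -> ex_RInt (ell_integrand k2) x y.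
Proof.
intros Hk; apply (ex_RInt_continuous (ell_integrand k2)).
intros z _; now apply ell_integrand_continuous.
Qed.

Lemma ell_integrand_ge_1 (k2 t : R) : 0 <= k2 < 1 -> 1 <= ell_integrand k2 t.
Proof.
intros Hk; unfold ell_integrand.
assert (H := ell_radicand_pos k2 t Hk).
apply Rle_trans with (/ 1); [lra|]; apply Rinv_le_contravar.
- now apply sqrt_lt_R0.
- rewrite <- sqrt_1 at 2; apply sqrt_le_1_alt; generalize (sin_sqr_bound t); nra.
Qed.

Lemma is_derive_ellF (k2 x : R) : 0 <= k2 < 1 -> is_derive (ellF k2) x (ell_integrand k2 x).
Proof.
intros Hk; apply (is_derive_RInt (ell_integrand k2) (ellF k2) 0).
- apply filter_forall; intros y; apply (RInt_correct (ell_integrand k2)).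
  now apply ell_integrand_ex_RInt.
- now apply ell_integrand_continuous.
Qed.

Lemma ellF_0 (k2 : R) : ellF k2 0 = 0.
Proof. unfold ellF; now rewrite RInt_point. Qed.

(** With the square root multiplied across and [x], [y] taken to be amplitudes, this expresses an
    increment of the inverse function by an increment of its argument. *)
Lemma ellF_mean_value (k2 x y : R) : 0 <= k2 < 1 ->
  exists z, Rmin x y <= z <= Rmax x y /\
    y - x = sqrt (1 - k2 * sin z ^ 2) * (ellF k2 y - ellF k2 x).
Proof.
intros Hk.
destruct (MVT_gen (ellF k2) x y (ell_integrand k2)) as [z [Hz Hv]].
- intros t _; now apply is_derive_ellF.
- intros t _; apply continuity_pt_filterlim.
  apply (ex_derive_continuous (ellF k2)); eexists; now apply is_derive_ellF.
- exists z; split; [exact Hz|]; rewrite Hv; unfold ell_integrand.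
  assert (H := sqrt_lt_R0 _ (ell_radicand_pos k2 z Hk)); field; lra.
Qed.

(** The integrand is at least 1. Injectivity, surjectivity and monotonicity of the inverse all come
    from this bound. *)
Lemma ellF_expands (k2 x y : R) : 0 <= k2 < 1 -> x <= y -> y - x <= ellF k2 y - ellF k2 x.
Proof.
intros Hk Hxy.
destruct (MVT_gen (ellF k2) x y (ell_integrand k2)) as [z [_ Hv]].
- intros t _; now apply is_derive_ellF.
- intros t _; apply continuity_pt_filterlim.
  apply (ex_derive_continuous (ellF k2)); eexists; now apply is_derive_ellF.
- rewrite Hv; generalize (ell_integrand_ge_1 k2 z Hk); nra.
Qed.

Lemma ellF_inj (k2 x y : R) : 0 <= k2 < 1 -> ellF k2 x = ellF k2 y -> x = y.
Proof.
intros Hk E; destruct (Rle_dec x y) as [H|H].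
- generalize (ellF_expands k2 x y Hk H); lra.
- assert (H' : y <= x) by lra; generalize (ellF_expands k2 y x Hk H'); lra.
Qed.

Lemma ellF_jac_am (k2 u : R) : 0 <= k2 < 1 -> ellF k2 (jac_am k2 u) = u.
Proof.
intros Hk; unfold jac_am; apply epsilon_spec.
(* Expansion from the origin gives [ellF k2 (Rabs u) >= Rabs u] and the mirror bound, so [- Rabs u]
   and [Rabs u] bracket a solution. *)
assert (Hl : - Rabs u <= 0) by (generalize (Rabs_pos u); lra).
assert (Hr : 0 <= Rabs u) by apply Rabs_pos.
assert (H1 := ellF_expands k2 _ _ Hk Hl).
assert (H2 := ellF_expands k2 _ _ Hk Hr).
rewrite ellF_0 in H1, H2.
destruct (IVT_gen (ellF k2) (- Rabs u) (Rabs u) u) as [x [_ Hx]].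
- intros t; apply continuity_pt_filterlim.
  apply (ex_derive_continuous (ellF k2)); eexists; now apply is_derive_ellF.
- assert (H3 := Rle_abs u); assert (H4 := Rle_abs (- u)); rewrite Rabs_Ropp in H4.
  rewrite Rmin_left, Rmax_right by lra; lra.
- now exists x.
Qed.

Lemma jac_am_ellF (k2 x : R) : 0 <= k2 < 1 -> jac_am k2 (ellF k2 x) = x.
Proof. intros Hk; apply (ellF_inj k2); trivial; now apply ellF_jac_am. Qed.

Lemma jac_am_0 (k2 : R) : 0 <= k2 < 1 -> jac_am k2 0 = 0.
Proof. intros Hk; rewrite <- (ellF_0 k2) at 1; now apply jac_am_ellF. Qed.

Lemma jac_am_incr (k2 u v : R) : 0 <= k2 < 1 -> u <= v -> jac_am k2 u <= jac_am k2 v.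
Proof.
intros Hk Huv; apply Rnot_lt_le; intros H.
assert (H' := ellF_expands k2 _ _ Hk (Rlt_le _ _ H)).
rewrite !ellF_jac_am in H' by exact Hk; lra.
Qed.

Lemma ellF_opp (k2 x : R) : 0 <= k2 < 1 -> ellF k2 (- x) = - ellF k2 x.
Proof.
intros Hk.
assert (H1 : is_RInt (ell_integrand k2) (- 0) (- x) (ellF k2 (- x))).
{ rewrite Ropp_0; apply (RInt_correct (ell_integrand k2)).
  now apply ell_integrand_ex_RInt. }
apply (is_RInt_comp_opp (ell_integrand k2)) in H1.
assert (H2 : is_RInt (fun y => opp (ell_integrand k2 y)) 0 x (opp (ellF k2 x))).
{ apply (is_RInt_opp (ell_integrand k2)), (RInt_correct (ell_integrand k2)).
  now apply ell_integrand_ex_RInt. }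
rewrite <- (is_RInt_unique _ _ _ _ H1).
change (- ellF k2 x) with (opp (ellF k2 x)).
rewrite <- (is_RInt_unique _ _ _ _ H2).
apply RInt_ext; intros t _; unfold ell_integrand.
rewrite sin_neg; do 4 f_equal; ring.
Qed.

Lemma jac_am_opp (k2 u : R) : 0 <= k2 < 1 -> jac_am k2 (- u) = - jac_am k2 u.
Proof.
intros Hk; apply (ellF_inj k2); trivial.
now rewrite ellF_opp, !ellF_jac_am.
Qed.

(** The difference quotient equals [sqrt (1 - k2 * sin z ^ 2)] at an intermediate [z]. As this root
    is at most 1, [z] lies within [Rabs h] of the amplitude at [u], and continuity of the root
    finishes. *)
Lemma is_derive_jac_am (k2 u : R) : 0 <= k2 < 1 ->
  is_derive (jac_am k2) u (sqrt (1 - k2 * sin (jac_am k2 u) ^ 2)).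
Proof.
intros Hk; apply is_derive_Reals; intros eps Heps.
assert (Hc : continuous (fun t => sqrt (1 - k2 * sin t ^ 2)) (jac_am k2 u)).
{ apply (ex_derive_continuous (fun t => sqrt (1 - k2 * sin t ^ 2))); auto_derive.
  generalize (ell_radicand_pos k2 (jac_am k2 u) Hk); simpl; tauto. }
apply (proj1 (filterlim_locally _ _)) with (eps := mkposreal eps Heps) in Hc.
destruct Hc as [d Hd]; exists d; intros h Hh Hhd.
destruct (ellF_mean_value k2 (jac_am k2 u) (jac_am k2 (u + h)) Hk) as [z [Hz Hv]].
rewrite !ellF_jac_am in Hv by exact Hk.
replace (u + h - u) with h in Hv by ring.
rewrite Hv.
replace (sqrt (1 - k2 * sin z ^ 2) * h / h) with (sqrt (1 - k2 * sin z ^ 2)) by (field; exact Hh).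
apply (Hd z).
apply Rle_lt_trans with (Rabs h); [|exact Hhd].
change (Rabs (z - jac_am k2 u) <= Rabs h).
apply Rle_trans with (Rabs (jac_am k2 (u + h) - jac_am k2 u)).
- revert Hz; unfold Rmin, Rmax; destruct Rle_dec; intros Hz;
    unfold Rabs; repeat destruct Rcase_abs; lra.
- rewrite Hv, Rabs_mult.
  assert (H1 : Rabs (sqrt (1 - k2 * sin z ^ 2)) <= 1).
  { rewrite Rabs_pos_eq by apply sqrt_pos; rewrite <- sqrt_1 at 2.
    apply sqrt_le_1_alt; generalize (sin_sqr_bound z); nra. }
  generalize (Rabs_pos h); nra.
Qed.

(** The integrand is replaced by its maximum. The true growth of [K] is logarithmic, but this crude
    bound already controls the period. *)
Lemma ellK_le (k2 : R) : 0 <= k2 < 1 -> ellK k2 * sqrt (1 - k2) <= PI / 2.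
Proof.
intros Hk; assert (Hs : 0 < sqrt (1 - k2)) by (apply sqrt_lt_R0; lra).
assert (Hpi := PI_RGT_0).
assert (HK : ellK k2 <= RInt (fun _ => / sqrt (1 - k2)) 0 (PI / 2)).
{ apply (RInt_le (ell_integrand k2)).
  - lra.
  - now apply ell_integrand_ex_RInt.
  - apply ex_RInt_const.
  - intros t _; apply Rinv_le_contravar; [exact Hs|].
    apply sqrt_le_1_alt; generalize (sin_sqr_bound t); nra. }
rewrite RInt_const in HK; unfold scal in HK; simpl in HK; unfold mult in HK; simpl in HK.
apply Rmult_le_compat_r with (r := sqrt (1 - k2)) in HK; [|lra].
replace ((PI / 2 - 0) * / sqrt (1 - k2) * sqrt (1 - k2)) with (PI / 2) in HK by (field; lra).
exact HK.
Qed.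

(** With [p], [q] the two roots, the difference is [-(p^2 - q^2) / (p q (p + q))]. Here [p q >= m],
    and [p + q >= m] because [sqrt m >= m] for [m <= 1]. *)
Lemma Rinv_sqrt_Lipschitz (m x y : R) : 0 < m <= 1 -> m <= x -> m <= y ->
  Rabs (/ sqrt x - / sqrt y) <= / m ^ 2 * Rabs (x - y).
Proof.
intros [Hm H] Hx Hy.
assert (Hsm : m <= sqrt m).
{ rewrite <- (sqrt_pow2 m) at 1 by lra; apply sqrt_le_1_alt; nra. }
assert (Hsx : sqrt m <= sqrt x) by now apply sqrt_le_1_alt.
assert (Hsy : sqrt m <= sqrt y) by now apply sqrt_le_1_alt.
assert (Ex : sqrt x * sqrt x = x) by (apply sqrt_sqrt; lra).
assert (Ey : sqrt y * sqrt y = y) by (apply sqrt_sqrt; lra).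
assert (Em : sqrt m * sqrt m = m) by (apply sqrt_sqrt; lra).
set (p := sqrt x) in *; set (q := sqrt y) in *; set (s := sqrt m) in *.
rewrite <- Ex, <- Ey.
replace (/ p - / q) with (- / (p * q * (p + q)) * (p * p - q * q)) by (field; lra).
rewrite Rabs_mult, Rabs_Ropp; apply Rmult_le_compat_r; [apply Rabs_pos|].
assert (H1 : m <= p * q) by (rewrite <- Em; apply Rmult_le_compat; lra).
assert (H2 : m ^ 2 <= p * q * (p + q)).
{ replace (m ^ 2) with (m * m) by ring; apply Rmult_le_compat; lra. }
assert (H3 : 0 < m ^ 2) by (apply pow_lt, Hm).
rewrite Rabs_pos_eq by (apply Rlt_le, Rinv_0_lt_compat; lra).
now apply Rinv_le_contravar.
Qed.

Lemma ellK_Lipschitz (k x y : R) : k < 1 -> 0 <= x <= k -> 0 <= y <= k ->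
  Rabs (ellK x - ellK y) <= PI / 2 * / (1 - k) ^ 2 * Rabs (x - y).
Proof.
intros Hk Hx Hy; assert (Hpi := PI_RGT_0).
assert (Hx1 : 0 <= x < 1) by lra; assert (Hy1 : 0 <= y < 1) by lra.
unfold ellK, ellF.
change (Rabs (minus (RInt (ell_integrand x) 0 (PI / 2)) (RInt (ell_integrand y) 0 (PI / 2)))
  <= PI / 2 * / (1 - k) ^ 2 * Rabs (x - y)).
rewrite <- (RInt_minus (V := R_CompleteNormedModule)) by now apply ell_integrand_ex_RInt.
replace (PI / 2 * / (1 - k) ^ 2 * Rabs (x - y))
  with ((PI / 2 - 0) * (/ (1 - k) ^ 2 * Rabs (x - y))) by ring.
apply abs_RInt_le_const; [lra| |].
- apply (ex_RInt_minus (V := R_NormedModule)); now apply ell_integrand_ex_RInt.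
- intros t _; assert (Ht := sin_sqr_bound t).
  change (Rabs (ell_integrand x t - ell_integrand y t) <= / (1 - k) ^ 2 * Rabs (x - y)).
  eapply Rle_trans; [apply (Rinv_sqrt_Lipschitz (1 - k)); [lra|nra|nra]|].
  apply Rmult_le_compat_l; [apply Rlt_le, Rinv_0_lt_compat, pow_lt; lra|].
  replace (1 - x * sin t ^ 2 - (1 - y * sin t ^ 2)) with (- (sin t ^ 2) * (x - y)) by ring.
  rewrite Rabs_mult, Rabs_Ropp, (Rabs_pos_eq (sin t ^ 2)) by lra.
  generalize (Rabs_pos (x - y)); nra.
Qed.

Lemma ellK_continuous (k2 : R) : 0 < k2 < 1 -> continuous ellK k2.
Proof.
(* The midpoint of [k2] and 1 satisfies [1 - k = k - k2], so a radius below [k2] and [1 - k] keeps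
   [y] in [[0, k]], where the Lipschitz constant is fixed. *)
intros Hk; set (k := (k2 + 1) / 2); set (C := PI / 2 * / (1 - k) ^ 2).
assert (HC : 0 < C).
{ apply Rmult_lt_0_compat; [generalize PI_RGT_0; lra|].
  apply Rinv_0_lt_compat, pow_lt; unfold k; lra. }
apply (proj2 (filterlim_locally _ _)); intros eps; assert (He := cond_pos eps).
assert (Hd : 0 < Rmin (Rmin k2 (1 - k)) (eps / C)).
{ repeat apply Rmin_glb_lt; try (unfold k; lra); now apply Rdiv_lt_0_compat. }
exists (mkposreal _ Hd); intros y Hy.
change (Rabs (y - k2) < Rmin (Rmin k2 (1 - k)) (eps / C)) in Hy.
change (Rabs (ellK y - ellK k2) < eps).
assert (H1 : Rabs (y - k2) < k2)
  by (eapply Rlt_le_trans; [exact Hy|]; eapply Rle_trans; [apply Rmin_l|apply Rmin_l]).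
assert (H2 : Rabs (y - k2) < 1 - k)
  by (eapply Rlt_le_trans; [exact Hy|]; eapply Rle_trans; [apply Rmin_l|apply Rmin_r]).
assert (H3 : Rabs (y - k2) < eps / C) by (eapply Rlt_le_trans; [exact Hy|apply Rmin_r]).
apply Rabs_def2 in H1; apply Rabs_def2 in H2.
eapply Rle_lt_trans.
- apply (ellK_Lipschitz k); unfold k in *; lra.
- fold C; apply Rlt_le_trans with (C * (eps / C)).
  + now apply Rmult_lt_compat_l.
  + right; field; lra.
Qed.

(** * Orbits of the profile equation *)

(** In the application [a] is [omega - c^2/4]. The function [energy] below is twice the primitive of
    [force] that vanishes at 0. *)
Definition force (a c s : R) : R := s * (a + c / 2 * s ^ 2 - 3 / 16 * s ^ 4).
Definition energy (a c s : R) : R := a * s ^ 2 + c / 4 * s ^ 4 - s ^ 6 / 16.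

Record orbit (a c E : R) (u v : R -> R) : Prop := {
  orbit_pos : forall x, 0 < u x;
  orbit_du : forall x, is_derive u x (v x);
  orbit_dv : forall x, is_derive v x (force a c (u x));
  orbit_energy : forall x, v x ^ 2 = energy a c (u x) + E;
  orbit_even : forall x, u (- x) = u x;
  orbit_odd : forall x, v (- x) = - v x
}.

(** Both profiles are given through their square [rho]. With [q = rho'/rho] one has [u' = u q / 2]
    and [u'' = u (q'/2 + q^2/4)], so the equation divided by [u] and the energy law involve only
    [rho], [q] and [r]: identities that [field] can check. *)
Lemma sqrt_orbit (a c E : R) (rho q r u : R -> R) :
  (forall x, u x = sqrt (rho x)) ->
  (forall x, 0 < rho x) ->
  (forall x, is_derive rho x (rho x * q x)) ->
  (forall x, is_derive q x (r x)) ->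
  (forall x, r x / 2 + q x ^ 2 / 4 = a + c / 2 * rho x - 3 / 16 * rho x ^ 2) ->
  (forall x, rho x * q x ^ 2 / 4 = a * rho x + c / 4 * rho x ^ 2 - rho x ^ 3 / 16 + E) ->
  (forall x, rho (- x) = rho x) ->
  (forall x, q (- x) = - q x) ->
  orbit a c E u (fun x => u x * (q x / 2)).
Proof.
intros Hu Hpos Hrho Hq Heq Hen Heven Hodd.
assert (Hs : forall x, 0 < u x) by (intros x; rewrite Hu; apply sqrt_lt_R0, Hpos).
assert (Hss : forall x, u x ^ 2 = rho x).
{ intros x; rewrite Hu, <- Rsqr_pow2; apply Rsqr_sqrt, Rlt_le, Hpos. }
assert (Heven' : forall x, u (- x) = u x) by (intros x; now rewrite !Hu, Heven).
assert (Hd : forall x, is_derive u x (u x * (q x / 2))).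
{ intros x; apply (is_derive_ext (fun x => sqrt (rho x))); [now intros t|]; evar_last.
  - apply (is_derive_comp sqrt rho); [|apply Hrho].
    apply is_derive_Reals, derivable_pt_lim_sqrt, Hpos.
  - unfold scal; simpl; unfold mult; simpl.
    rewrite <- Hu, <- (Hss x); field.
    generalize (Hs x); lra. }
split; trivial.
- intros x; evar_last.
  + apply (is_derive_mult u (fun x => q x / 2)).
    * apply Hd.
    * apply (is_derive_ext (fun x => / 2 * q x)); [intros t; simpl; field|].
      apply is_derive_scal, Hq.
    * intros n m; apply Rmult_comm.
  + unfold plus, mult; simpl; unfold force.
    replace (u x ^ 4) with ((u x ^ 2) ^ 2) by ring.
    rewrite !Hss, <- Heq; field.
- intros x; unfold energy.
  replace (u x ^ 6) with ((u x ^ 2) ^ 3) by ring.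
  replace (u x ^ 4) with ((u x ^ 2) ^ 2) by ring.
  rewrite Rpow_mult_distr, !Hss, <- Hen; field.
- intros x; rewrite Heven', Hodd; field.
Qed.

(* Polynomials in a solution [u] (for [PU]) and its derivative [v] (for [PV]). *)
Inductive pexpr : Set :=
  | PC : R -> pexpr
  | PU : pexpr
  | PV : pexpr
  | PAdd : pexpr -> pexpr -> pexpr
  | PMul : pexpr -> pexpr -> pexpr.

Fixpoint peval (e : pexpr) (s t : R) : R :=
  match e with
  | PC r => r
  | PU => s
  | PV => t
  | PAdd e1 e2 => peval e1 s t + peval e2 s t
  | PMul e1 e2 => peval e1 s t * peval e2 s t
  end.

Definition pforce (a c : R) : pexpr :=
  PMul PU (PAdd (PC a) (PAdd (PMul (PC (c / 2)) (PMul PU PU))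
    (PMul (PC (- (3 / 16))) (PMul (PMul PU PU) (PMul PU PU))))).

Lemma peval_pforce (a c s t : R) : peval (pforce a c) s t = force a c s.
Proof. unfold force; simpl; ring. Qed.

(** The Lie derivative along the flow of the equation. It stays inside [pexpr] because the force is
    polynomial, and it does not involve the energy level, so one expression serves both
    solutions. *)
Fixpoint pder (a c : R) (e : pexpr) : pexpr :=
  match e with
  | PC _ => PC 0
  | PU => PV
  | PV => pforce a c
  | PAdd e1 e2 => PAdd (pder a c e1) (pder a c e2)
  | PMul e1 e2 => PAdd (PMul (pder a c e1) e2) (PMul e1 (pder a c e2))
  end.

Lemma is_derive_peval (a c E : R) (u v : R -> R) (e : pexpr) (x : R) :
  orbit a c E u v ->
  is_derive (fun x => peval e (u x) (v x)) x (peval (pder a c e) (u x) (v x)).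
Proof.
intros H; induction e as [r| | |e1 IH1 e2 IH2|e1 IH1 e2 IH2].
- exact (is_derive_const (V := R_NormedModule) r x).
- apply (orbit_du _ _ _ _ _ H).
- cbn [pder]; rewrite peval_pforce; apply (orbit_dv _ _ _ _ _ H).
- apply (is_derive_plus (V := R_NormedModule) _ _ _ _ _ IH1 IH2).
- apply (is_derive_mult _ _ _ _ _ IH1 IH2); intros n m; apply Rmult_comm.
Qed.

(** A single [C] is both a bound and a Lipschitz constant, which lets the induction pass through
    products: there the Lipschitz constant is [C1 C2 + C1 C2]. *)
Lemma peval_Lipschitz (e : pexpr) (M : R) : 0 <= M ->
  exists C, 0 <= C /\ forall s t s' t',
    Rabs s <= M -> Rabs t <= M -> Rabs s' <= M -> Rabs t' <= M ->
    Rabs (peval e s t) <= C /\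
    Rabs (peval e s t - peval e s' t') <= C * (Rabs (s - s') + Rabs (t - t')).
Proof.
intros HM; induction e as [r| | |e1 [C1 [P1 H1]] e2 [C2 [P2 H2]]|e1 [C1 [P1 H1]] e2 [C2 [P2 H2]]].
- exists (Rabs r); split; [apply Rabs_pos|]; intros s t s' t' _ _ _ _; simpl.
  rewrite Rminus_diag, Rabs_R0.
  generalize (Rabs_pos r) (Rabs_pos (s - s')) (Rabs_pos (t - t')); split; nra.
- exists (M + 1); split; [lra|]; intros s t s' t' ? ? ? ?; simpl.
  generalize (Rabs_pos (s - s')) (Rabs_pos (t - t')); split; nra.
- exists (M + 1); split; [lra|]; intros s t s' t' ? ? ? ?; simpl.
  generalize (Rabs_pos (s - s')) (Rabs_pos (t - t')); split; nra.
- exists (C1 + C2); split; [lra|]; intros s t s' t' a b a' b'; simpl.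
  destruct (H1 _ _ _ _ a b a' b') as [B1 L1]; destruct (H2 _ _ _ _ a b a' b') as [B2 L2].
  split.
  + eapply Rle_trans; [apply Rabs_triang|lra].
  + replace (peval e1 s t + peval e2 s t - (peval e1 s' t' + peval e2 s' t'))
      with ((peval e1 s t - peval e1 s' t') + (peval e2 s t - peval e2 s' t')) by ring.
    eapply Rle_trans; [apply Rabs_triang|lra].
- exists (2 * C1 * C2); split; [nra|]; intros s t s' t' a b a' b'; simpl.
  destruct (H1 _ _ _ _ a b a' b') as [B1 L1]; destruct (H2 _ _ _ _ a b a' b') as [B2 L2].
  destruct (H2 _ _ _ _ a' b' a b) as [B2' _].
  split.
  + rewrite Rabs_mult.
    generalize (Rabs_pos (peval e1 s t)) (Rabs_pos (peval e2 s t)); nra.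
  + replace (peval e1 s t * peval e2 s t - peval e1 s' t' * peval e2 s' t')
      with (peval e1 s t * (peval e2 s t - peval e2 s' t')
            + (peval e1 s t - peval e1 s' t') * peval e2 s' t') by ring.
    eapply Rle_trans; [apply Rabs_triang|].
    rewrite !Rabs_mult.
    set (d := Rabs (s - s') + Rabs (t - t')) in *.
    apply Rle_trans with (C1 * (C2 * d) + C1 * d * C2); [|right; ring].
    apply Rplus_le_compat; apply Rmult_le_compat; trivial; apply Rabs_pos.
Qed.

Definition pder_n (a c : R) (n : nat) : pexpr := Nat.iter n (pder a c) PU.

Lemma Derive_n_orbit_diff (a c E1 E2 : R) (u1 v1 u2 v2 : R -> R) (n : nat) (x : R) :
  orbit a c E1 u1 v1 -> orbit a c E2 u2 v2 ->
  Derive_n (fun x => u1 x - u2 x) n x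
  = peval (pder_n a c n) (u1 x) (v1 x) - peval (pder_n a c n) (u2 x) (v2 x).
Proof.
intros H1 H2; revert x; induction n as [|n IH]; intros x; [reflexivity|].
cbn [Derive_n]; rewrite (Derive_ext _ _ _ IH).
apply is_derive_unique.
apply (is_derive_minus (V := R_NormedModule));
  eapply is_derive_peval; eassumption.
Qed.

(** * Comparison of derivatives and the Gronwall inequality *)

Lemma is_derive_le (f g df dg : R -> R) (x y : R) : x <= y ->
  (forall t, x <= t <= y -> is_derive f t (df t)) ->
  (forall t, x <= t <= y -> is_derive g t (dg t)) ->
  (forall t, x <= t <= y -> df t <= dg t) ->
  f y - f x <= g y - g x.
Proof.
intros Hxy Hf Hg Hle.
destruct (MVT_gen (fun t => g t - f t) x y (fun t => dg t - df t)) as [z [Hz Hv]].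
- intros t Ht; rewrite Rmin_left, Rmax_right in Ht by exact Hxy.
  apply (is_derive_minus (V := R_NormedModule)); [apply Hg|apply Hf]; lra.
- intros t Ht; rewrite Rmin_left, Rmax_right in Ht by exact Hxy.
  apply continuity_pt_filterlim, (ex_derive_continuous (fun t => g t - f t)).
  eexists; apply (is_derive_minus (V := R_NormedModule)); [apply Hg|apply Hf]; lra.
- rewrite Rmin_left, Rmax_right in Hz by exact Hxy.
  generalize (Hle z Hz); nra.
Qed.

Lemma exp_le_compat (x y : R) : x <= y -> exp x <= exp y.
Proof. intros [H|<-]; [now apply Rlt_le, exp_increasing|apply Rle_refl]. Qed.

Lemma Gronwall (w dw : R -> R) (K x : R) : 0 <= x ->
  (forall t, 0 <= t <= x -> is_derive w t (dw t)) ->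
  (forall t, 0 <= t <= x -> dw t <= K * w t) ->
  w x <= w 0 * exp (K * x).
Proof.
intros Hx Hw Hle.
assert (H : w x * exp (- (K * x)) - w 0 * exp (- (K * 0)) <= 0 - 0).
{ apply (is_derive_le (fun t => w t * exp (- (K * t))) (fun _ => 0)
    (fun t => (dw t - K * w t) * exp (- (K * t))) (fun _ => 0)); trivial.
  - intros t Ht; evar_last.
    + apply (is_derive_mult w (fun t => exp (- (K * t)))).
      * now apply Hw.
      * auto_derive; [trivial|reflexivity].
      * intros n m; apply Rmult_comm.
    + unfold plus, mult; simpl; ring.
  - intros t _; apply (is_derive_const (V := R_NormedModule)).
  - intros t Ht; generalize (exp_pos (- (K * t))) (Hle t Ht); nra. }
rewrite Rmult_0_r, Ropp_0, exp_0, exp_Ropp in H.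
assert (He := exp_pos (K * x)).
apply Rmult_le_reg_r with (/ exp (K * x)); [now apply Rinv_0_lt_compat|].
rewrite Rmult_assoc, Rinv_r by lra; lra.
Qed.

(** * Tail and gap estimates *)

(** The interface shared by the periodic wave, with [l] its half period, and the soliton, with any
    [l]. The energy level is hidden behind an existential so that the constants below depend on
    neither it nor [l]. *)
Record pulse (a c l : R) (u v : R -> R) : Prop := {
  pulse_orbit : exists E, E <= 0 /\ orbit a c E u v;
  pulse_max : forall x, u x <= u 0;
  pulse_decr : forall x, 0 <= x <= l -> v x <= 0
}.

Lemma pulse_pos (a c l : R) (u v : R -> R) (x : R) : pulse a c l u v -> 0 < u x.
Proof. intros [[E [_ H]] _ _]; apply (orbit_pos _ _ _ _ _ H). Qed.

Lemma pulse_du (a c l : R) (u v : R -> R) (x : R) : pulse a c l u v -> is_derive u x (v x).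
Proof. intros [[E [_ H]] _ _]; apply (orbit_du _ _ _ _ _ H). Qed.

Lemma pulse_dv (a c l : R) (u v : R -> R) (x : R) :
  pulse a c l u v -> is_derive v x (force a c (u x)).
Proof. intros [[E [_ H]] _ _]; apply (orbit_dv _ _ _ _ _ H). Qed.

Lemma pulse_velocity_0 (a c l : R) (u v : R -> R) : pulse a c l u v -> v 0 = 0.
Proof.
intros [[E [_ H]] _ _]; generalize (orbit_odd _ _ _ _ _ H 0); rewrite Ropp_0; lra.
Qed.

Lemma pulse_energy_le (a c l : R) (u v : R -> R) (x : R) : pulse a c l u v ->
  v x ^ 2 <= a * u x ^ 2 + c / 4 * u x ^ 4.
Proof.
intros [[E [HE H]] _ _]; rewrite (orbit_energy _ _ _ _ _ H); unfold energy.
assert (0 <= u x ^ 6) by (replace (u x ^ 6) with ((u x ^ 3) ^ 2) by ring; apply pow2_ge_0).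
lra.
Qed.

Lemma pulse_velocity_le (a c M : R) : 0 <= a -> 
  exists C, 0 <= C /\ forall l u v x, pulse a c l u v -> u x <= M -> Rabs (v x) <= C * u x.
Proof.
(* The energy bound gives [v^2 <= (a + B) u^2] with [B = Rabs c * M ^ 2]. Since
   [a + B <= (1 + a + B)^2], adding 1 avoids a square root. *)
intros Ha; exists (1 + a + Rabs c * M ^ 2).
assert (HcM : 0 <= Rabs c * M ^ 2) by (apply Rmult_le_pos; [apply Rabs_pos|apply pow2_ge_0]).
split; [lra|]; intros l u v x H HM.
assert (Hu := pulse_pos _ _ _ _ _ x H).
rewrite <- (Rabs_pos_eq ((1 + a + Rabs c * M ^ 2) * u x)) by nra.
apply Rsqr_le_abs_0; unfold Rsqr.
assert (He := pulse_energy_le _ _ _ _ _ x H).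
assert (Hc := Rle_abs c).
assert (HuM : u x ^ 2 <= M ^ 2) by nra.
assert (H1 : c / 4 * u x ^ 4 <= Rabs c * M ^ 2 * u x ^ 2).
{ apply Rle_trans with (Rabs c * (u x ^ 2 * u x ^ 2)).
  - replace (u x ^ 4) with (u x ^ 2 * u x ^ 2) by ring.
    assert (0 <= u x ^ 2 * u x ^ 2) by nra.
    generalize (Rabs_pos c); nra.
  - rewrite Rmult_assoc; apply Rmult_le_compat_l; [apply Rabs_pos|].
    apply Rmult_le_compat_r; [apply pow2_ge_0|exact HuM]. }
set (B := Rabs c * M ^ 2) in *.
apply Rle_trans with ((a + B) * u x ^ 2); [lra|].
replace ((1 + a + B) * u x * ((1 + a + B) * u x)) with ((1 + a + B) ^ 2 * u x ^ 2) by ring.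
apply Rmult_le_compat_r; [apply pow2_ge_0|nra].
Qed.

Lemma pulse_antitone (a c l : R) (u v : R -> R) (x y : R) : pulse a c l u v ->
  0 <= x -> x <= y -> y <= l -> u y <= u x.
Proof.
intros H H0 Hxy Hy.
assert (u y - u x <= 0 - 0); [|lra].
apply (is_derive_le u (fun _ => 0) v (fun _ => 0)); trivial.
- intros t _; exact (pulse_du _ _ _ _ _ t H).
- intros t _; exact (is_derive_const (V := R_NormedModule) 0 t).
- intros t Ht; apply (pulse_decr _ _ _ _ _ H); lra.
Qed.

Lemma continuous_of_is_derive (f : R -> R) (x d : R) : is_derive f x d -> continuous f x.
Proof. intros H; apply (ex_derive_continuous f); now exists d. Qed.

Lemma ex_RInt_of_continuous (f : R -> R) (x y : R) :
  (forall t, continuous f t) -> ex_RInt f x y.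
Proof. intros H; apply (ex_RInt_continuous f); intros z _; apply H. Qed.

Lemma continuous_pow2 (f : R -> R) (x : R) : continuous f x -> continuous (fun t => f t ^ 2) x.
Proof.
intros H; apply (continuous_ext (fun t => mult (f t) (f t))).
- intros t; unfold mult; simpl; ring.
- now apply (continuous_mult f f).
Qed.

Lemma RInt_le_primitive (f g dg : R -> R) (x y : R) : x <= y ->
  (forall t, continuous f t) ->
  (forall t, x <= t <= y -> is_derive g t (dg t)) ->
  (forall t, x <= t <= y -> f t <= dg t) ->
  RInt f x y <= g y - g x.
Proof.
intros Hxy Hf Hg Hle.
replace (RInt f x y) with (RInt f x y - RInt f x x)
  by (rewrite RInt_point; unfold zero; simpl; ring).
apply (is_derive_le (fun t => RInt f x t) g f dg); trivial.
intros t _; apply (is_derive_RInt f (fun t => RInt f x t) x); [|apply Hf].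
apply filter_forall; intros z; apply (RInt_correct f), ex_RInt_of_continuous, Hf.
Qed.

Lemma pulse_continuous (a c l : R) (u v : R -> R) (x : R) : pulse a c l u v -> continuous u x.
Proof. intros H; exact (continuous_of_is_derive _ _ _ (pulse_du _ _ _ _ _ x H)). Qed.

Lemma pulse_velocity_continuous (a c l : R) (u v : R -> R) (x : R) :
  pulse a c l u v -> continuous v x.
Proof. intros H; exact (continuous_of_is_derive _ _ _ (pulse_dv _ _ _ _ _ x H)). Qed.

(** Below the level [d] the linear term dominates: [v' >= (a/2) u], hence
    [u^2 <= d u <= (2 d / a) v']. Integrating leaves [v l - v x], where [v l <= 0] removes the far
    end and [- v x] is at most a multiple of [u x]. *)
Lemma pulse_tail_exponential (a c : R) : 0 < a ->
  exists d C, 0 < d /\ 0 <= C /\ forall l u v x, pulse a c l u v -> 0 <= x <= l -> u x <= d ->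
    RInt (fun t => u t ^ 2) x l <= C * u x.
Proof.
intros Ha.
assert (Hc := Rabs_pos c).
(* Since [d <= 1], the squares and fourth powers of values up to [d] are again at most [d], and
   [d (Rabs c + 1) <= a] then bounds the nonlinear part of the force factor by [a / 2]. *)
set (d := Rmin 1 (a / (Rabs c + 1))).
assert (Hd : 0 < d).
{ apply Rmin_glb_lt; [lra|]; apply Rdiv_lt_0_compat; lra. }
assert (Hd1 : d <= 1) by apply Rmin_l.
assert (Hd2 : d * (Rabs c + 1) <= a).
{ apply Rle_trans with (a / (Rabs c + 1) * (Rabs c + 1)).
  - apply Rmult_le_compat_r; [lra|apply Rmin_r].
  - right; field; lra. }
destruct (pulse_velocity_le a c d (Rlt_le _ _ Ha)) as [C [HC Hv]].
exists d, (2 * d / a * C).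
assert (Hda : 0 < 2 * d / a) by (apply Rdiv_lt_0_compat; lra).
split; [exact Hd|]; split; [nra|].
intros l u v x H Hx Hux.
apply Rle_trans with (2 * d / a * v l - 2 * d / a * v x).
- apply (RInt_le_primitive _ (fun t => 2 * d / a * v t) (fun t => 2 * d / a * force a c (u t))).
  + apply Hx.
  + intros t; apply continuous_pow2, (pulse_continuous _ _ _ _ _ t H).
  + intros t _; apply is_derive_scal, (pulse_dv _ _ _ _ _ t H).
  + intros t Ht.
    assert (Hut : u t <= u x) by (apply (pulse_antitone _ _ _ _ _ x t H); lra).
    assert (Hp := pulse_pos _ _ _ _ _ t H).
    assert (Hs : a / 2 <= a + c / 2 * u t ^ 2 - 3 / 16 * u t ^ 4).
    { assert (Hs2 : u t ^ 2 <= d) by nra.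
      assert (Hs4 : u t ^ 4 <= d).
      { replace (u t ^ 4) with (u t ^ 2 * u t ^ 2) by ring; nra. }
      assert (- Rabs c <= c) by (generalize (Rle_abs (- c)); rewrite Rabs_Ropp; lra).
      assert (- (Rabs c * d) <= c * u t ^ 2).
      { assert (0 <= u t ^ 2) by apply pow2_ge_0; nra. }
      lra. }
    unfold force.
    apply Rle_trans with (2 * d / a * (u t * (a / 2))).
    * replace (2 * d / a * (u t * (a / 2))) with (d * u t) by (field; lra); nra.
    * apply Rmult_le_compat_l; [lra|]; apply Rmult_le_compat_l; lra.
- assert (Hl := pulse_decr _ _ _ _ _ H l).
  assert (Hvx := Hv l u v x H Hux).
  assert (- v x <= Rabs (v x)) by (rewrite <- Rabs_Ropp; apply Rle_abs).
  rewrite Rmult_assoc, <- Rmult_minus_distr_l; apply Rmult_le_compat_l; lra.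
Qed.

(* Here [v / u] plays the role of [v] above: its derivative is
   [c/4 u^2 - u^4/8 - E/u^2]. *)
Lemma pulse_tail_algebraic (c : R) : 0 < c ->
  exists d C, 0 < d /\ 0 <= C /\ forall l u v x, pulse 0 c l u v -> 0 <= x <= l -> u x <= d ->
    RInt (fun t => u t ^ 2) x l <= C * u x.
Proof.
(* For [u^2 <= c] one has [c/4 u^2 - u^4/8 >= c/8 u^2], whence the factor [8 / c]. The factor
   [1 + c] comes from [v^2 <= c/4 u^4 <= ((1 + c) u^2)^2]. *)
intros Hc; exists (sqrt c), (8 / c * (1 + c)).
assert (H8 : 0 < 8 / c) by (apply Rdiv_lt_0_compat; lra).
split; [now apply sqrt_lt_R0|]; split; [nra|].
intros l u v x H Hx Hux.
assert (Hp := fun t => pulse_pos _ _ _ _ _ t H).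
apply Rle_trans with (8 / c * (v l / u l) - 8 / c * (v x / u x)).
- destruct (pulse_orbit _ _ _ _ _ H) as [E [HE Ho]].
  apply (RInt_le_primitive _ (fun t => 8 / c * (v t / u t))
    (fun t => 8 / c * ((force 0 c (u t) * u t - v t * v t) / u t ^ 2))).
  + apply Hx.
  + intros t; apply continuous_pow2, (pulse_continuous _ _ _ _ _ t H).
  + intros t _; apply is_derive_scal; evar_last.
    * apply is_derive_div; [exact (pulse_dv _ _ _ _ _ t H)|exact (pulse_du _ _ _ _ _ t H)|].
      apply Rgt_not_eq, Hp.
    * field; apply Rgt_not_eq, Hp.
  + intros t Ht.
    assert (Hut : u t <= u x) by (apply (pulse_antitone _ _ _ _ _ x t H); lra).
    assert (Hs : u t ^ 2 <= c).
    { rewrite <- (Rsqr_sqrt c) by lra; unfold Rsqr; generalize (Hp t); nra. }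
    assert (Ht2 : 0 < u t ^ 2) by (generalize (Hp t); nra).
    replace (v t * v t) with (v t ^ 2) by ring.
    rewrite (orbit_energy _ _ _ _ _ Ho); unfold force, energy.
    apply Rmult_le_reg_l with (c / 8); [lra|].
    apply Rmult_le_reg_r with (u t ^ 2); [exact Ht2|].
    set (s := u t) in *.
    replace (c / 8 * (8 / c * ((s * (0 + c / 2 * s ^ 2 - 3 / 16 * s ^ 4) * s -
      (0 * s ^ 2 + c / 4 * s ^ 4 - s ^ 6 / 16 + E)) / s ^ 2)) * s ^ 2)
      with (c / 4 * s ^ 4 - s ^ 6 / 8 - E) by (field; split; [apply Rgt_not_eq, Hp|lra]).
    replace (s ^ 6) with (s ^ 2 * s ^ 4) by ring.
    assert (0 <= s ^ 4) by (replace (s ^ 4) with (s ^ 2 * s ^ 2) by ring; nra).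
    replace (c / 8 * s ^ 2 * s ^ 2) with (c / 8 * s ^ 4) by ring; nra.
- assert (Hl : v l <= 0) by (apply (pulse_decr _ _ _ _ _ H l); lra).
  assert (He := pulse_energy_le _ _ _ _ _ x H).
  assert (Hvx : Rabs (v x) <= (1 + c) * u x ^ 2).
  { assert (0 <= u x ^ 2) by apply pow2_ge_0.
    rewrite <- (Rabs_pos_eq ((1 + c) * u x ^ 2)) by nra.
    apply Rsqr_le_abs_0; unfold Rsqr.
    replace ((1 + c) * u x ^ 2 * ((1 + c) * u x ^ 2)) with ((1 + c) ^ 2 * u x ^ 4) by ring.
    assert (0 <= u x ^ 4) by (replace (u x ^ 4) with (u x ^ 2 * u x ^ 2) by ring; nra).
    nra. }
  assert (- v x <= Rabs (v x)) by (rewrite <- Rabs_Ropp; apply Rle_abs).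
  rewrite Rmult_assoc, <- Rmult_minus_distr_l; apply Rmult_le_compat_l; [lra|].
  assert (v l / u l <= 0).
  { apply Rmult_le_reg_r with (u l); [apply Hp|].
    unfold Rdiv; rewrite Rmult_assoc, Rinv_l by (apply Rgt_not_eq, Hp); lra. }
  assert (- (v x / u x) <= (1 + c) * u x); [|lra].
  apply Rmult_le_reg_r with (u x); [apply Hp|].
  replace (- (v x / u x) * u x) with (- v x) by (field; apply Rgt_not_eq, Hp); lra.
Qed.

Lemma pulse_tail (a c : R) : 0 < a \/ (a = 0 /\ 0 < c) ->
  exists d C, 0 < d /\ 0 <= C /\ forall l u v x, pulse a c l u v -> 0 <= x <= l -> u x <= d ->
    RInt (fun t => u t ^ 2) x l <= C * u x.
Proof.
intros [Ha|[-> Hc]]; [now apply pulse_tail_exponential|now apply pulse_tail_algebraic].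
Qed.

(** * Distance of two pulses in the phase plane *)

Definition gap (u1 v1 u2 v2 : R -> R) (x : R) : R := (u1 x - u2 x) ^ 2 + (v1 x - v2 x) ^ 2.

Lemma pulse_gap_continuous (a c l : R) (u1 v1 u2 v2 : R -> R) (x : R) :
  pulse a c l u1 v1 -> pulse a c l u2 v2 -> continuous (gap u1 v1 u2 v2) x.
Proof.
intros H1 H2.
apply (continuous_plus (fun x => (u1 x - u2 x) ^ 2) (fun x => (v1 x - v2 x) ^ 2));
  apply continuous_pow2.
- apply (continuous_minus u1 u2); eapply pulse_continuous; eassumption.
- apply (continuous_minus v1 v2); eapply pulse_velocity_continuous; eassumption.
Qed.

(** Both velocities vanish at 0 by oddness, so the initial gap is that of the peaks alone. If [C] is
    a Lipschitz constant of the force, [2 p q + 2 q r] with [Rabs r <= C * Rabs p] is at most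
    [(1 + C) (p^2 + q^2)]. *)
Lemma pulse_gap_growth (a c M : R) : 0 <= a -> 0 <= M ->
  exists K, 0 <= K /\ forall l u1 v1 u2 v2 x,
    pulse a c l u1 v1 -> pulse a c l u2 v2 -> u1 0 <= M -> u2 0 <= M -> 0 <= x ->
    gap u1 v1 u2 v2 x <= (u1 0 - u2 0) ^ 2 * exp (K * x).
Proof.
intros Ha HM.
destruct (peval_Lipschitz (pforce a c) M HM) as [C [HC Hlip]].
exists (1 + C); split; [lra|]; intros l u1 v1 u2 v2 x H1 H2 HM1 HM2 Hx.
assert (H0 : gap u1 v1 u2 v2 0 = (u1 0 - u2 0) ^ 2).
{ unfold gap; rewrite (pulse_velocity_0 _ _ _ _ _ H1), (pulse_velocity_0 _ _ _ _ _ H2); ring. }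
rewrite <- H0.
apply (Gronwall _ (fun t => 2 * (u1 t - u2 t) * (v1 t - v2 t)
    + 2 * (v1 t - v2 t) * (force a c (u1 t) - force a c (u2 t)))); trivial.
- intros t _; unfold gap.
  assert (Hu := is_derive_minus (V := R_NormedModule) _ _ _ _ _
    (pulse_du _ _ _ _ _ t H1) (pulse_du _ _ _ _ _ t H2)).
  assert (Hv := is_derive_minus (V := R_NormedModule) _ _ _ _ _
    (pulse_dv _ _ _ _ _ t H1) (pulse_dv _ _ _ _ _ t H2)).
  evar_last.
  + apply (is_derive_plus (V := R_NormedModule));
      [apply (is_derive_pow _ 2 _ _ Hu)|apply (is_derive_pow _ 2 _ _ Hv)].
  + unfold plus, minus, plus, opp; simpl; ring.
- intros t _; unfold gap.
  assert (Hb : Rabs (force a c (u1 t) - force a c (u2 t)) <= C * Rabs (u1 t - u2 t)).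
  (* The force does not depend on the velocity slot. Filling it with 0 on both sides makes its
     contribution to the Lipschitz bound vanish. *)
  { rewrite <- (peval_pforce a c (u1 t) 0), <- (peval_pforce a c (u2 t) 0).
    destruct (Hlip (u1 t) 0 (u2 t) 0) as [_ L].
    - rewrite Rabs_pos_eq by apply Rlt_le, (pulse_pos _ _ _ _ _ t H1).
      generalize (pulse_max _ _ _ _ _ H1 t); lra.
    - rewrite Rabs_R0; exact HM.
    - rewrite Rabs_pos_eq by apply Rlt_le, (pulse_pos _ _ _ _ _ t H2).
      generalize (pulse_max _ _ _ _ _ H2 t); lra.
    - rewrite Rabs_R0; exact HM.
    - rewrite Rminus_diag, Rabs_R0, Rplus_0_r in L; exact L. }
  set (p := u1 t - u2 t) in *; set (q := v1 t - v2 t) in *.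
  set (r := force a c (u1 t) - force a c (u2 t)) in *.
  assert (Hqr : q * r <= Rabs q * (C * Rabs p)).
  { eapply Rle_trans; [apply Rle_abs|]; rewrite Rabs_mult.
    apply Rmult_le_compat_l; [apply Rabs_pos|exact Hb]. }
  rewrite <- (pow2_abs p) in *; rewrite <- (pow2_abs q) in *.
  assert (Hpq : p * q <= Rabs p * Rabs q) by (rewrite <- Rabs_mult; apply Rle_abs).
  assert (H2pq : 2 * (Rabs p * Rabs q) <= Rabs p ^ 2 + Rabs q ^ 2)
    by (generalize (pow2_ge_0 (Rabs p - Rabs q)); lra).
  nra.
Qed.

(** Core and tail are separated at [x]: Gronwall on [[0, x]], and on [[x, l]] the crude bound of the
    gap by [2 (1 + Cv^2) (u1^2 + u2^2)]. Smallness at the single point [x] suffices because both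
    pulses decrease afterwards. *)
Lemma pulse_gap_RInt (a c M : R) : 0 < a \/ (a = 0 /\ 0 < c) -> 0 <= M ->
  exists K C d, 0 < d /\ 0 <= C /\ forall l u1 v1 u2 v2 x,
    pulse a c l u1 v1 -> pulse a c l u2 v2 -> u1 0 <= M -> u2 0 <= M -> 0 <= x <= l ->
    u1 x <= d -> u2 x <= d ->
    RInt (gap u1 v1 u2 v2) 0 l <= x * ((u1 0 - u2 0) ^ 2 * exp (K * x)) + C * (u1 x + u2 x).
Proof.
intros Hac HM.
assert (Ha : 0 <= a) by lra.
destruct (pulse_gap_growth a c M Ha HM) as [K [HK Hgrow]].
destruct (pulse_tail a c Hac) as [d [C [Hd [HC Htail]]]].
destruct (pulse_velocity_le a c d Ha) as [Cv [HCv Hv]].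
exists K, (2 * (1 + Cv ^ 2) * C), d.
split; [exact Hd|]; split; [generalize (pow2_ge_0 Cv); nra|].
intros l u1 v1 u2 v2 x H1 H2 HM1 HM2 Hx Hd1 Hd2.
assert (Hgc := fun t => pulse_gap_continuous _ _ _ _ _ _ _ t H1 H2).
rewrite <- (RInt_Chasles (gap u1 v1 u2 v2) 0 x l) by (apply ex_RInt_of_continuous, Hgc).
unfold plus; simpl; apply Rplus_le_compat.
- eapply Rle_trans.
  + apply (RInt_le (gap u1 v1 u2 v2) (fun _ => (u1 0 - u2 0) ^ 2 * exp (K * x))).
    * lra.
    * apply ex_RInt_of_continuous, Hgc.
    * apply ex_RInt_const.
    * intros t Ht; eapply Rle_trans; [apply (Hgrow l u1 v1 u2 v2 t); trivial; lra|].
      apply Rmult_le_compat_l; [apply pow2_ge_0|].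
      apply exp_le_compat, Rmult_le_compat_l; lra.
  + rewrite RInt_const; unfold scal; simpl; unfold mult; simpl; lra.
- assert (Hc1 : forall t, continuous (fun t => u1 t ^ 2) t)
    by (intros t; apply continuous_pow2, (pulse_continuous _ _ _ _ _ t H1)).
  assert (Hc2 : forall t, continuous (fun t => u2 t ^ 2) t)
    by (intros t; apply continuous_pow2, (pulse_continuous _ _ _ _ _ t H2)).
  apply Rle_trans with
    (RInt (fun t => scal (2 * (1 + Cv ^ 2)) (plus (u1 t ^ 2) (u2 t ^ 2))) x l).
  + apply RInt_le.
    * lra.
    * apply ex_RInt_of_continuous, Hgc.
    * apply (ex_RInt_scal (V := R_NormedModule)), (ex_RInt_plus (V := R_NormedModule));
        apply ex_RInt_of_continuous; assumption.
    * intros t Ht; unfold scal, plus, gap; simpl; unfold mult; simpl.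
      assert (Hu1 : u1 t <= u1 x) by (apply (pulse_antitone _ _ _ _ _ x t H1); lra).
      assert (Hu2 : u2 t <= u2 x) by (apply (pulse_antitone _ _ _ _ _ x t H2); lra).
      assert (B1 := Hv l u1 v1 t H1 (Rle_trans _ _ _ Hu1 Hd1)).
      assert (B2 := Hv l u2 v2 t H2 (Rle_trans _ _ _ Hu2 Hd2)).
      assert (S1 : v1 t ^ 2 <= Cv ^ 2 * u1 t ^ 2).
      { rewrite <- (pow2_abs (v1 t)), <- Rpow_mult_distr.
        apply pow_incr; split; [apply Rabs_pos|exact B1]. }
      assert (S2 : v2 t ^ 2 <= Cv ^ 2 * u2 t ^ 2).
      { rewrite <- (pow2_abs (v2 t)), <- Rpow_mult_distr.
        apply pow_incr; split; [apply Rabs_pos|exact B2]. }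
      generalize (pow2_ge_0 (u1 t + u2 t)) (pow2_ge_0 (v1 t + v2 t)); lra.
  + rewrite (RInt_scal (V := R_CompleteNormedModule)).
    2: apply (ex_RInt_plus (V := R_NormedModule)); apply ex_RInt_of_continuous; assumption.
    rewrite (RInt_plus (V := R_CompleteNormedModule))
      by (apply ex_RInt_of_continuous; assumption).
    unfold scal, plus; simpl; unfold mult; simpl.
    assert (T1 := Htail l u1 v1 x H1 Hx Hd1).
    assert (T2 := Htail l u2 v2 x H2 Hx Hd2).
    replace (2 * (1 + Cv * (Cv * 1)) * C * (u1 x + u2 x))
      with (2 * (1 + Cv * (Cv * 1)) * (C * u1 x + C * u2 x)) by ring.
    apply Rmult_le_compat_l; [nra|]; simpl in T1, T2; lra.
Qed.

(** * Convergence in Sobolev norm *)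

Lemma RInt_even (f : R -> R) (l : R) : (forall t, continuous f t) -> (forall t, f (- t) = f t) ->
  RInt f (- l) l = 2 * RInt f 0 l.
Proof.
intros Hf Heven.
assert (H : is_RInt f (- 0) (- l) (RInt f 0 (- l))).
{ rewrite Ropp_0; apply (RInt_correct f), ex_RInt_of_continuous, Hf. }
apply (is_RInt_comp_opp f) in H; apply (is_RInt_unique (V := R_CompleteNormedModule)) in H.
rewrite (RInt_ext _ (fun t => opp (f t))) in H by (intros t _; now rewrite Heven).
rewrite (RInt_opp (V := R_CompleteNormedModule)) in H by apply ex_RInt_of_continuous, Hf.
rewrite <- (RInt_Chasles f (- l) 0 l) by apply ex_RInt_of_continuous, Hf.
rewrite <- (opp_RInt_swap f 0 (- l)) by apply ex_RInt_of_continuous, Hf.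
rewrite <- H; unfold plus, opp; simpl; ring.
Qed.

Lemma pulse_Derive_n_diff (a c M : R) (n : nat) : 0 <= a -> 0 <= M ->
  exists C, 0 <= C /\ forall l u1 v1 u2 v2,
    pulse a c l u1 v1 -> pulse a c l u2 v2 -> u1 0 <= M -> u2 0 <= M -> 0 <= l ->
    RInt (fun x => Derive_n (fun x => u1 x - u2 x) n x ^ 2) (- l) l
    <= C * RInt (gap u1 v1 u2 v2) 0 l.
Proof.
intros Ha HM.
destruct (pulse_velocity_le a c M Ha) as [Cv [HCv Hv]].
set (M' := (1 + Cv) * M).
assert (HM' : 0 <= M') by (unfold M'; nra).
destruct (peval_Lipschitz (pder_n a c n) M' HM') as [C [HC Hlip]].
(* The outer 2 undoes the reduction of [[-l, l]] to [[0, l]] by evenness. The inner one is from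
   [(A + B)^2 <= 2 (A^2 + B^2)]. *)
exists (2 * (2 * C ^ 2)); split; [generalize (pow2_ge_0 C); lra|].
intros l u1 v1 u2 v2 H1 H2 HM1 HM2 Hl.
destruct (pulse_orbit _ _ _ _ _ H1) as [E1 [_ O1]].
destruct (pulse_orbit _ _ _ _ _ H2) as [E2 [_ O2]].
assert (Hgc := fun t => pulse_gap_continuous _ _ _ _ _ _ _ t H1 H2).
assert (Heven : forall t, gap u1 v1 u2 v2 (- t) = gap u1 v1 u2 v2 t).
{ intros t; unfold gap.
  rewrite (orbit_even _ _ _ _ _ O1), (orbit_even _ _ _ _ _ O2),
    (orbit_odd _ _ _ _ _ O1), (orbit_odd _ _ _ _ _ O2); ring. }
assert (Hp : forall E u v e, orbit a c E u v ->
  forall t, continuous (fun x => peval e (u x) (v x)) t).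
{ intros E u v e O t; eapply continuous_of_is_derive, is_derive_peval, O. }
assert (Hb : forall u v, pulse a c l u v -> u 0 <= M ->
  forall t, Rabs (u t) <= M' /\ Rabs (v t) <= M').
{ intros u v H H0 t.
  assert (Hut := pulse_pos _ _ _ _ _ t H); assert (Hm := pulse_max _ _ _ _ _ H t).
  assert (Hvt := Hv l u v t H (Rle_trans _ _ _ Hm H0)).
  rewrite (Rabs_pos_eq (u t)) by lra; unfold M'; split; nra. }
rewrite Rmult_assoc, <- (RInt_scal (V := R_CompleteNormedModule))
  by apply ex_RInt_of_continuous, Hgc.
rewrite <- RInt_even.
- apply RInt_le; [lra| | |].
  + apply (ex_RInt_ext (fun x => (peval (pder_n a c n) (u1 x) (v1 x)
                              - peval (pder_n a c n) (u2 x) (v2 x)) ^ 2)).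
    { intros x _; now rewrite <- (Derive_n_orbit_diff a c E1 E2 u1 v1 u2 v2 n x O1 O2). }
    apply ex_RInt_of_continuous; intros t; apply continuous_pow2.
    apply (continuous_minus (fun x => peval (pder_n a c n) (u1 x) (v1 x))
      (fun x => peval (pder_n a c n) (u2 x) (v2 x))); eapply Hp; eassumption.
  + apply (ex_RInt_scal (V := R_NormedModule)), ex_RInt_of_continuous, Hgc.
  + intros x _; rewrite (Derive_n_orbit_diff a c E1 E2 u1 v1 u2 v2 n x O1 O2).
    destruct (Hb _ _ H1 HM1 x) as [A1 B1]; destruct (Hb _ _ H2 HM2 x) as [A2 B2].
    destruct (Hlip _ _ _ _ A1 B1 A2 B2) as [_ L].
    rewrite <- pow2_abs.
    apply Rle_trans with ((C * (Rabs (u1 x - u2 x) + Rabs (v1 x - v2 x))) ^ 2).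
    { apply pow_incr; split; [apply Rabs_pos|exact L]. }
    rewrite Rpow_mult_distr; unfold scal; simpl; unfold mult; simpl; unfold gap.
    rewrite <- (pow2_abs (u1 x - u2 x)), <- (pow2_abs (v1 x - v2 x)).
    generalize (pow2_ge_0 (Rabs (u1 x - u2 x) - Rabs (v1 x - v2 x))) (pow2_ge_0 C); nra.
- intros t; apply (continuous_scal_r (V := R_NormedModule)), Hgc.
- intros t; now rewrite Heven.
Qed.

Lemma is_lim_sum_f_R0 (f : nat -> R -> R) (x : Rbar) (m : nat) :
  (forall n, is_lim (f n) x 0) -> is_lim (fun t => sum_f_R0 (fun n => f n t) m) x 0.
Proof.
intros H; induction m as [|m IH]; simpl; [apply H|].
replace (Finite 0) with (Finite (0 + 0)) by (f_equal; ring).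
now apply is_lim_plus'.
Qed.

(** The order of choices matters: first a level [h], then a point [x] where the limit pulse is below
    [h], and only then [l], so large that the peaks are close enough to beat the exponentials at
    [x]. *)
Lemma pulse_gap_lim (a c l0 : R) (U V : R -> R -> R) (u v : R -> R) :
  0 < a \/ (a = 0 /\ 0 < c) ->
  (forall l, l0 < l -> pulse a c l (U l) (V l)) -> (forall l, pulse a c l u v) ->
  is_lim (fun l => U l 0) p_infty (u 0) ->
  (forall e, 0 < e -> exists x, 0 <= x /\ u x < e) ->
  is_lim (fun l => RInt (gap (U l) (V l) u v) 0 l) p_infty 0.
Proof.
intros Hac HU Hu Hlim Hinf.
assert (Hu0 : 0 < u 0) by exact (pulse_pos _ _ _ _ _ 0 (Hu 0)).
assert (Ha : 0 <= a) by lra.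
assert (HM : 0 <= u 0 + 1) by lra.
destruct (pulse_gap_RInt a c (u 0 + 1) Hac HM) as [K [C [d [Hd [HC Hint]]]]].
destruct (pulse_gap_growth a c (u 0 + 1) Ha HM) as [K' [HK' Hgrow]].
apply is_lim_spec in Hlim; apply is_lim_spec; intros eps.
assert (Heps := cond_pos eps).
(* The two values at [x] will be below [h] and [2 h <= d], so the tail costs at most
   [3 C h <= 3 eps / 8]; the core will cost at most [eps / 4]. *)
set (h := Rmin (d / 2) (eps / (8 * (C + 1)))).
assert (Hh : 0 < h).
{ apply Rmin_glb_lt; [lra|]; apply Rdiv_lt_0_compat; lra. }
assert (Hhd : h <= d / 2) by apply Rmin_l.
assert (HhC : C * h <= eps / 8).
{ assert (h * (8 * (C + 1)) <= eps).
  { apply Rle_trans with (eps / (8 * (C + 1)) * (8 * (C + 1))).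
    - apply Rmult_le_compat_r; [lra|apply Rmin_r].
    - right; field; lra. }
  nra. }
destruct (Hinf h Hh) as [x [Hx Hux]].
(* The three terms serve in turn: to bound the peaks by [u 0 + 1] and their squared distance by [B],
   to get [U l x] within [h] of [u x], and to make the core integral small. The summand in [x + 1]
   covers [x = 0]. *)
set (B := Rmin 1 (Rmin (h ^ 2 / exp (K' * x)) (eps / (4 * (x + 1) * exp (K * x))))).
assert (He := exp_pos (K * x)); assert (He' := exp_pos (K' * x)).
assert (H4 : 0 < 4 * (x + 1) * exp (K * x)) by (apply Rmult_lt_0_compat; lra).
assert (HB : 0 < B).
{ unfold B; repeat apply Rmin_glb_lt; [lra| |]; apply Rdiv_lt_0_compat; trivial.
  now apply pow_lt. }
assert (HB1 : B <= 1) by apply Rmin_l.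
assert (HB2 : B * exp (K' * x) <= h ^ 2).
{ apply Rle_trans with (h ^ 2 / exp (K' * x) * exp (K' * x)); [|right; field; lra].
  apply Rmult_le_compat_r; [lra|].
  eapply Rle_trans; [apply Rmin_r|apply Rmin_l]. }
assert (HB3 : B * (4 * (x + 1) * exp (K * x)) <= eps).
{ apply Rle_trans with (eps / (4 * (x + 1) * exp (K * x)) * (4 * (x + 1) * exp (K * x))).
  - apply Rmult_le_compat_r; [lra|].
    eapply Rle_trans; [apply Rmin_r|apply Rmin_r].
  - right; field; split; lra. }
destruct (Hlim (mkposreal B HB)) as [l1 Hl1]; simpl in Hl1.
exists (Rmax l0 (Rmax l1 x)); intros l Hl.
assert (Hl0 : l0 < l) by (eapply Rle_lt_trans; [apply Rmax_l|exact Hl]).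
assert (Hl1' : l1 < l).
{ eapply Rle_lt_trans; [|exact Hl]; eapply Rle_trans; [apply Rmax_l|apply Rmax_r]. }
assert (Hlx : x < l).
{ eapply Rle_lt_trans; [|exact Hl]; eapply Rle_trans; [apply Rmax_r|apply Rmax_r]. }
assert (HUl := HU l Hl0); specialize (Hl1 l Hl1').
assert (Hsq : (U l 0 - u 0) ^ 2 <= B).
{ rewrite <- pow2_abs; generalize (Rabs_pos (U l 0 - u 0)); nra. }
assert (HU0 : U l 0 <= u 0 + 1) by (apply Rabs_lt_between' in Hl1; lra).
assert (Hu1 : u 0 <= u 0 + 1) by lra.
assert (HUx : U l x < 2 * h).
{ assert (Hg := Hgrow l _ _ _ _ x HUl (Hu l) HU0 Hu1 Hx).
  assert (Hle : (U l x - u x) ^ 2 <= h ^ 2).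
  { apply Rle_trans with (gap (U l) (V l) u v x).
    - unfold gap; generalize (pow2_ge_0 (V l x - v x)); lra.
    - nra. }
  nra. }
assert (HUd : U l x <= d) by lra.
assert (Hud : u x <= d) by lra.
assert (HI := Hint l _ _ _ _ x HUl (Hu l) HU0 Hu1 (conj Hx (Rlt_le _ _ Hlx)) HUd Hud).
assert (Hpos : 0 <= RInt (gap (U l) (V l) u v) 0 l).
{ apply RInt_ge_0; [lra| |].
  - apply ex_RInt_of_continuous; intros t; exact (pulse_gap_continuous _ _ _ _ _ _ _ t HUl (Hu l)).
  - intros t _; unfold gap; generalize (pow2_ge_0 (U l t - u t)) (pow2_ge_0 (V l t - v t)); lra. }
rewrite Rminus_0_r, Rabs_pos_eq by exact Hpos.
eapply Rle_lt_trans; [exact HI|].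
assert (Hx1 : x * ((U l 0 - u 0) ^ 2 * exp (K * x)) <= eps / 4).
{ apply Rle_trans with (B * ((x + 1) * exp (K * x))); [|lra].
  rewrite (Rmult_comm ((U l 0 - u 0) ^ 2)), <- Rmult_assoc, Rmult_comm.
  apply Rmult_le_compat; trivial; [apply pow2_ge_0|nra|nra]. }
nra.
Qed.

Lemma pulse_Hm_lim (a c l0 : R) (U V : R -> R -> R) (u v : R -> R) (m : nat) :
  0 < a \/ (a = 0 /\ 0 < c) ->
  (forall l, l0 < l -> pulse a c l (U l) (V l)) -> (forall l, pulse a c l u v) ->
  is_lim (fun l => U l 0) p_infty (u 0) ->
  (forall e, 0 < e -> exists x, 0 <= x /\ u x < e) ->
  is_lim (fun l => Hm_norm m l (fun x => U l x - u x)) p_infty 0.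
Proof.
intros Hac HU Hu Hlim Hinf.
assert (Hu0 : 0 < u 0) by exact (pulse_pos _ _ _ _ _ 0 (Hu 0)).
assert (Ha : 0 <= a) by lra.
assert (HM : 0 <= u 0 + 1) by lra.
assert (Hg := pulse_gap_lim a c l0 U V u v Hac HU Hu Hlim Hinf).
unfold Hm_norm; rewrite <- sqrt_0.
apply (is_lim_comp_continuous
  (fun l => sum_f_R0 (fun n => RInt (fun x => Derive_n (fun x => U l x - u x) n x ^ 2) (- l) l) m)
  sqrt p_infty 0).
2: apply continuous_sqrt.
apply (is_lim_sum_f_R0 (fun n l => RInt (fun x => Derive_n (fun x => U l x - u x) n x ^ 2) (- l) l)).
intros n; destruct (pulse_Derive_n_diff a c (u 0 + 1) n Ha HM) as [C [HC Hn]].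
assert (Hub : Rbar_locally p_infty (fun l => U l 0 <= u 0 + 1)).
{ apply is_lim_spec in Hlim; destruct (Hlim (mkposreal 1 Rlt_0_1)) as [B HB].
  exists B; intros l Hl; specialize (HB l Hl); simpl in HB.
  apply Rabs_lt_between' in HB; lra. }
apply (is_lim_le_le_loc (fun _ => 0) (fun l => C * RInt (gap (U l) (V l) u v) 0 l)).
- apply (filter_imp (fun l => U l 0 <= u 0 + 1 /\ Rmax 0 l0 < l)).
  + intros l [HU0 Hl].
    assert (H0 : 0 < l) by (eapply Rle_lt_trans; [apply Rmax_l|exact Hl]).
    assert (H1 : l0 < l) by (eapply Rle_lt_trans; [apply Rmax_r|exact Hl]).
    assert (HUl := HU l H1).
    split.
    * destruct (pulse_orbit _ _ _ _ _ HUl) as [E1 [_ O1]].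
      destruct (pulse_orbit _ _ _ _ _ (Hu l)) as [E2 [_ O2]].
      apply RInt_ge_0; [lra| |intros t _; apply pow2_ge_0].
      apply (ex_RInt_ext (fun x => (peval (pder_n a c n) (U l x) (V l x)
                              - peval (pder_n a c n) (u x) (v x)) ^ 2)).
      { intros x _; now rewrite <- (Derive_n_orbit_diff a c E1 E2 _ _ _ _ n x O1 O2). }
      apply ex_RInt_of_continuous; intros t; apply continuous_pow2.
      apply (continuous_minus (fun x => peval (pder_n a c n) (U l x) (V l x))
        (fun x => peval (pder_n a c n) (u x) (v x)));
        eapply continuous_of_is_derive, is_derive_peval; eassumption.
    * apply Hn; trivial; lra.
  + apply filter_and; [exact Hub|]; exists (Rmax 0 l0); trivial.
- apply is_lim_const.
- replace (Finite 0) with (Rbar_mult C 0) by (simpl; f_equal; ring).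
  now apply is_lim_scal_l.
Qed.

(** * The periodic profile *)

Section Elliptic.

(** The roots are kept abstract and the parameters tied to them by equations: the identities become
    rational in [e1], [e2], [e3], free of the root of [polyA]. *)
Variables e1 e2 e3 k2 b2 g : R.
Hypotheses (He1 : e1 < 0) (He2 : 0 < e2) (He3 : e2 < e3).
Hypothesis Hk2 : k2 = - e1 * (e3 - e2) / (e3 * (e2 - e1)).
Hypothesis Hb2 : b2 = - e3 * k2 / e1.
Hypothesis Hg : g = 2 / sqrt (e3 * (e2 - e1)).

Lemma elliptic_modulus : 0 <= k2 < 1.
Proof.
assert (Hp : 0 < e3 * (e2 - e1)) by (apply Rmult_lt_0_compat; lra).
rewrite Hk2; split.
- apply Rmult_le_pos; [nra|now apply Rlt_le, Rinv_0_lt_compat].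
- apply Rmult_lt_reg_r with (e3 * (e2 - e1)); [exact Hp|].
  unfold Rdiv; rewrite Rmult_assoc, Rinv_l by lra; nra.
Qed.

Lemma elliptic_complementary_modulus : 1 - k2 = e2 * (e3 - e1) / (e3 * (e2 - e1)).
Proof. rewrite Hk2; field; lra. Qed.

Lemma elliptic_beta2 : b2 = (e3 - e2) / (e2 - e1).
Proof. rewrite Hb2, Hk2; field; lra. Qed.

Lemma elliptic_g_pos : 0 < g.
Proof.
rewrite Hg; apply Rdiv_lt_0_compat; [lra|]; apply sqrt_lt_R0, Rmult_lt_0_compat; lra.
Qed.

Lemma elliptic_g_sqr : g ^ 2 = 4 / (e3 * (e2 - e1)).
Proof.
assert (Hp : 0 < e3 * (e2 - e1)) by (apply Rmult_lt_0_compat; lra).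
assert (Hs := sqrt_lt_R0 _ Hp).
rewrite Hg; rewrite <- (sqrt_sqrt (e3 * (e2 - e1))) at 2 by lra; field; lra.
Qed.

Let am (x : R) : R := jac_am k2 (x / (2 * g)).
Let N (t : R) : R := 1 - k2 * sin t ^ 2.
Let D (t : R) : R := 1 + b2 * sin t ^ 2.

(* [rho], seen as a function of [x] through [am], is the squared profile; [q = rho'/rho] and
   [r = q'], as required by [sqrt_orbit]. *)
Let rho (t : R) : R := e3 * N t / D t.
Let q (t : R) : R := - (k2 + b2) * (sin t * cos t) / (g * sqrt (N t) * D t).
Let r (t : R) : R := - (k2 + b2) / (2 * g ^ 2) *
  ((cos t ^ 2 - sin t ^ 2) / D t + k2 * sin t ^ 2 * cos t ^ 2 / (sqrt (N t) ^ 2 * D t)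
   - 2 * b2 * sin t ^ 2 * cos t ^ 2 / D t ^ 2).

Lemma elliptic_D_pos (t : R) : 0 < D t.
Proof.
unfold D; rewrite elliptic_beta2.
assert (0 < (e3 - e2) / (e2 - e1)) by (apply Rdiv_lt_0_compat; lra).
generalize (sin_sqr_bound t); nra.
Qed.

Lemma elliptic_N_pos (t : R) : 0 < N t.
Proof. apply ell_radicand_pos, elliptic_modulus. Qed.

Lemma is_derive_elliptic_am (x : R) : is_derive am x (sqrt (N (am x)) / (2 * g)).
Proof.
assert (Hgp := elliptic_g_pos).
evar_last.
- apply (is_derive_comp (jac_am k2) (fun x => x / (2 * g))).
  + apply is_derive_jac_am, elliptic_modulus.
  + auto_derive; [trivial|reflexivity].
- unfold N, am, scal; simpl; unfold mult; simpl; field; lra.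
Qed.

Lemma is_derive_comp_am (f : R -> R) (x d : R) :
  is_derive f (am x) d -> is_derive (fun x => f (am x)) x (d * (sqrt (N (am x)) / (2 * g))).
Proof.
intros H; evar_last.
- apply (is_derive_comp f am); [exact H|apply is_derive_elliptic_am].
- unfold scal; simpl; unfold mult; simpl; ring.
Qed.

Lemma is_derive_elliptic_rho (x : R) :
  is_derive (fun x => rho (am x)) x (rho (am x) * q (am x)).
Proof.
assert (Hgp := elliptic_g_pos).
assert (HN := elliptic_N_pos (am x)); assert (HD := elliptic_D_pos (am x)).
assert (HS := sqrt_lt_R0 _ HN).
evar_last.
- apply is_derive_comp_am; unfold rho, N, D; auto_derive.
  + generalize HD; unfold D; simpl; lra.
  + reflexivity.
- unfold rho, q.
  (* Once [N] is the square of its root [n], the whole goal is rational in [n], and [field]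
     applies. *)
  replace (e3 * N (am x) / D (am x)) with (e3 * sqrt (N (am x)) ^ 2 / D (am x))
    by (rewrite <- Rsqr_pow2, Rsqr_sqrt by lra; reflexivity).
  set (n := sqrt (N (am x))) in *.
  unfold D in *; set (t := am x) in *; clearbody n.
  field; repeat split; lra.
Qed.

Lemma is_derive_elliptic_q (x : R) : is_derive (fun x => q (am x)) x (r (am x)).
Proof.
assert (Hgp := elliptic_g_pos).
assert (HN := elliptic_N_pos (am x)); assert (HD := elliptic_D_pos (am x)).
assert (HS := sqrt_lt_R0 _ HN).
evar_last.
- apply is_derive_comp_am; unfold q, N, D; auto_derive.
  + generalize HN HD HS; unfold N, D; simpl; intros HN' HD' HS'.
    repeat split; try lra.
    apply Rgt_not_eq; repeat apply Rmult_lt_0_compat; trivial.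
  + reflexivity.
- unfold r, N, D in *; set (t := am x) in *.
  replace (1 + - (k2 * (sin t * (sin t * 1)))) with (1 - k2 * sin t ^ 2) by ring.
  set (n := sqrt (1 - k2 * sin t ^ 2)) in *; clearbody n.
  field; repeat split; lra.
Qed.


Definition elliptic_profile (x : R) : R :=
  sqrt (e3 * jac_dn k2 (x / (2 * g)) ^ 2 / (1 + b2 * jac_sn k2 (x / (2 * g)) ^ 2)).

Lemma elliptic_profile_rho (x : R) : elliptic_profile x = sqrt (rho (am x)).
Proof.
unfold elliptic_profile, rho, D, jac_dn, jac_sn; fold (am x); fold (N (am x)).
rewrite <- (Rsqr_pow2 (sqrt (N (am x)))), Rsqr_sqrt; [reflexivity|].
apply Rlt_le, elliptic_N_pos.
Qed.

Lemma elliptic_rho_pos (t : R) : 0 < rho t.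
Proof.
assert (HN := elliptic_N_pos t); assert (HD := elliptic_D_pos t).
apply Rdiv_lt_0_compat; [apply Rmult_lt_0_compat; lra|exact HD].
Qed.

Lemma elliptic_rho_le (t : R) : rho t <= e3.
Proof.
assert (HN := elliptic_N_pos t); assert (HD := elliptic_D_pos t).
assert (HS := sin_sqr_bound t); assert (Hk := elliptic_modulus).
assert (Hb : 0 < b2) by (rewrite elliptic_beta2; apply Rdiv_lt_0_compat; lra).
apply Rmult_le_reg_r with (D t); [exact HD|].
unfold rho, Rdiv; rewrite Rmult_assoc, Rinv_l by lra.
unfold N, D; rewrite Rmult_1_r; apply Rmult_le_compat_l; [lra|nra].
Qed.

Lemma elliptic_am_opp (x : R) : am (- x) = - am x.
Proof.
assert (Hgp := elliptic_g_pos).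
unfold am; replace (- x / (2 * g)) with (- (x / (2 * g))) by (field; lra).
apply jac_am_opp, elliptic_modulus.
Qed.

Lemma elliptic_am_0 : am 0 = 0.
Proof. unfold am; rewrite Rdiv_0_l; apply jac_am_0, elliptic_modulus. Qed.

Lemma elliptic_am_half_period : am (2 * g * ellK k2) = PI / 2.
Proof.
assert (Hgp := elliptic_g_pos).
unfold am; replace (2 * g * ellK k2 / (2 * g)) with (ellK k2) by (field; lra).
apply jac_am_ellF, elliptic_modulus.
Qed.

Lemma cos_sqr (t : R) : cos t ^ 2 = 1 - sin t ^ 2.
Proof. generalize (sin2_cos2 t); unfold Rsqr; intros; nra. Qed.

(** The orbit identities contain [q] only through its square, which is rational in [sin t ^ 2]. *)
Lemma elliptic_q_sqr (t : R) :
  q t ^ 2 = (k2 + b2) ^ 2 * sin t ^ 2 * (1 - sin t ^ 2) / (g ^ 2 * N t * D t ^ 2).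
Proof.
assert (Hgp := elliptic_g_pos).
assert (HN := elliptic_N_pos t); assert (HD := elliptic_D_pos t).
assert (HS := sqrt_lt_R0 _ HN).
rewrite <- cos_sqr; unfold q.
rewrite <- (sqrt_sqrt (N t)) at 2 by lra.
field; repeat split; lra.
Qed.

(** The constants are Vieta's: with [rho = u^2] the energy law reads [u'^2 = -(rho - e1)(rho -
    e2)(rho - e3) / 16]. *)
Lemma elliptic_orbit :
  orbit (- (e1 * e2 + e1 * e3 + e2 * e3) / 16) ((e1 + e2 + e3) / 4) (e1 * e2 * e3 / 16)
    elliptic_profile (fun x => elliptic_profile x * (q (am x) / 2)).
Proof.
(* [H0] and [H1] concern the numerators of [N] and [D] as functions of [S = sin^2]; they discharge
   the nonvanishing conditions of [field]. *)
assert (H0 : forall S, 0 <= S <= 1 -> 0 < e3 * (e2 - e1) + e1 * (e3 - e2) * S).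
{ intros S HS; assert (0 < e2 * (e3 - e1)) by (apply Rmult_lt_0_compat; lra).
  assert (0 <= - e1 * (e3 - e2) * (1 - S)) by (repeat apply Rmult_le_pos; lra); lra. }
assert (H1 : forall S, 0 <= S <= 1 -> 0 < e2 - e1 + (e3 - e2) * S) by
  (intros S HS; assert (0 <= (e3 - e2) * S) by (apply Rmult_le_pos; lra); lra).
assert (HN : forall t, N t = (e3 * (e2 - e1) + e1 * (e3 - e2) * sin t ^ 2) / (e3 * (e2 - e1))).
{ intros t; unfold N; rewrite Hk2; field; lra. }
assert (HD : forall t, D t = (e2 - e1 + (e3 - e2) * sin t ^ 2) / (e2 - e1)).
{ intros t; unfold D; rewrite elliptic_beta2; field; lra. }
apply (sqrt_orbit _ _ _ (fun x => rho (am x)) (fun x => q (am x)) (fun x => r (am x))).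
- intros x; apply elliptic_profile_rho.
- intros x; apply elliptic_rho_pos.
- apply is_derive_elliptic_rho.
- apply is_derive_elliptic_q.
- intros x; rewrite elliptic_q_sqr; unfold r, rho.
  rewrite cos_sqr, pow2_sqrt by apply Rlt_le, elliptic_N_pos.
  rewrite HN, HD, elliptic_g_sqr, elliptic_beta2, Hk2.
  assert (HS := sin_sqr_bound (am x)); set (S := sin (am x) ^ 2) in *; clearbody S.
  specialize (H0 S HS); specialize (H1 S HS).
  field; repeat split; try lra.
- intros x; rewrite elliptic_q_sqr; unfold rho.
  rewrite HN, HD, elliptic_g_sqr, elliptic_beta2, Hk2.
  assert (HS := sin_sqr_bound (am x)); set (S := sin (am x) ^ 2) in *; clearbody S.
  specialize (H0 S HS); specialize (H1 S HS).
  field; repeat split; lra.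
- intros x; rewrite elliptic_am_opp; unfold rho, N, D; rewrite sin_neg.
  now replace ((- sin (am x)) ^ 2) with (sin (am x) ^ 2) by ring.
- intros x; rewrite elliptic_am_opp; unfold q, N, D; rewrite sin_neg, cos_neg.
  replace ((- sin (am x)) ^ 2) with (sin (am x) ^ 2) by ring.
  unfold Rdiv; ring.
Qed.

Lemma elliptic_profile_0 : elliptic_profile 0 = sqrt e3.
Proof.
rewrite elliptic_profile_rho, elliptic_am_0; unfold rho, N, D; rewrite sin_0.
f_equal; field.
Qed.

(** The trough of the wave. As [e2] will tend to 0 while the soliton stays positive, this value
    forces the period to blow up. *)
Lemma elliptic_profile_half_period : elliptic_profile (2 * g * ellK k2) = sqrt e2.
Proof.
rewrite elliptic_profile_rho, elliptic_am_half_period; unfold rho, N, D; rewrite sin_PI2.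
rewrite pow1, !Rmult_1_r, elliptic_complementary_modulus, elliptic_beta2.
f_equal; field; repeat split; lra.
Qed.

(** The energy is nonpositive because [e1] is the only negative root. On the half period the
    amplitude runs through [[0, PI / 2]], where sine and cosine are nonnegative, so [q <= 0]. *)
Lemma elliptic_pulse :
  exists v, pulse (- (e1 * e2 + e1 * e3 + e2 * e3) / 16) ((e1 + e2 + e3) / 4)
    (2 * g * ellK k2) elliptic_profile v.
Proof.
assert (Hgp := elliptic_g_pos); assert (Hk := elliptic_modulus).
exists (fun x => elliptic_profile x * (q (am x) / 2)); split.
- exists (e1 * e2 * e3 / 16); split; [|exact elliptic_orbit].
  assert (0 < e2 * e3) by (apply Rmult_lt_0_compat; lra); nra.
- intros x; rewrite elliptic_profile_0, elliptic_profile_rho.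
  apply sqrt_le_1_alt, elliptic_rho_le.
- intros x Hx.
  assert (Ht : 0 <= am x <= PI / 2).
  { rewrite <- elliptic_am_0, <- elliptic_am_half_period at 1; unfold am.
    split; apply jac_am_incr; trivial; unfold Rdiv; apply Rmult_le_compat_r; try lra;
      apply Rlt_le, Rinv_0_lt_compat; lra. }
  assert (Hs : 0 <= sin (am x)) by (apply sin_ge_0; generalize PI_RGT_0; lra).
  assert (Hc : 0 <= cos (am x)) by (apply cos_ge_0; generalize PI_RGT_0; lra).
  assert (HN := sqrt_lt_R0 _ (elliptic_N_pos (am x))); assert (HD := elliptic_D_pos (am x)).
  assert (Hb : 0 < b2) by (rewrite elliptic_beta2; apply Rdiv_lt_0_compat; lra).
  assert (Hu : 0 <= elliptic_profile x) by apply sqrt_pos.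
  assert (Hq : 0 <= - q (am x)); [|nra].
  unfold q; replace (- (- (k2 + b2) * (sin (am x) * cos (am x)) / (g * sqrt (N (am x)) * D (am x))))
    with ((k2 + b2) * (sin (am x) * cos (am x)) / (g * sqrt (N (am x)) * D (am x)))
    by (field; repeat split; lra).
  apply Rmult_le_pos; [apply Rmult_le_pos; [lra|now apply Rmult_le_pos]|].
  apply Rlt_le, Rinv_0_lt_compat; repeat apply Rmult_lt_0_compat; trivial.
Qed.

End Elliptic.

(** * The soliton, the period and the limit *)

Lemma cosh_ge_1 (x : R) : 1 <= cosh x.
Proof.
unfold cosh; rewrite exp_Ropp.
assert (H := exp_pos x).
apply Rmult_le_reg_r with (exp x); [exact H|].
replace ((exp x + / exp x) / 2 * exp x) with ((exp x ^ 2 + 1) / 2) by (field; lra).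
generalize (pow2_ge_0 (exp x - 1)); lra.
Qed.

Lemma cosh_ge_half (x : R) : x / 2 <= cosh x.
Proof.
unfold cosh; assert (H := exp_pos (- x)).
assert (H' := exp_ineq1_le x); lra.
Qed.

Lemma sinh_sqr (x : R) : sinh x ^ 2 = cosh x ^ 2 - 1.
Proof.
unfold sinh, cosh; rewrite exp_Ropp; field; apply Rgt_not_eq, exp_pos.
Qed.

Lemma sinh_ge_0 (x : R) : 0 <= x -> 0 <= sinh x.
Proof.
intros Hx; unfold sinh.
assert (H : exp (- x) <= exp x); [|lra].
destruct Hx as [Hx|<-]; [|rewrite Ropp_0; apply Rle_refl].
apply Rlt_le, exp_increasing; lra.
Qed.

Lemma cosh_opp (x : R) : cosh (- x) = cosh x.
Proof. unfold cosh; rewrite Ropp_involutive; field. Qed.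

Lemma sinh_opp (x : R) : sinh (- x) = - sinh x.
Proof. unfold sinh; rewrite Ropp_involutive; field. Qed.

Section Soliton.

Variables omega c : R.
Hypothesis Hoc : c ^ 2 / 4 < omega \/ (omega = c ^ 2 / 4 /\ 0 < c).

Lemma omega_pos : 0 < omega.
Proof. destruct Hoc as [H|[-> H]]; generalize (pow2_ge_0 c); [lra|nra]. Qed.

Lemma sqrt_omega_pos : 0 < sqrt omega.
Proof. apply sqrt_lt_R0, omega_pos. Qed.

Lemma sqrt_omega_sqr : sqrt omega ^ 2 = omega.
Proof. apply pow2_sqrt, Rlt_le, omega_pos. Qed.

(** The product of the two factors is [4 omega - c^2]. Only the second may vanish, and it does
    exactly in the algebraic case. *)
Lemma sqrt_omega_bounds : 0 < 2 * sqrt omega + c /\ 0 <= 2 * sqrt omega - c.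
Proof.
assert (Hw := sqrt_omega_pos); assert (Hw2 := sqrt_omega_sqr).
set (w := sqrt omega) in *.
destruct Hoc as [H|[H H']].
- assert (0 < (2 * w - c) * (2 * w + c)) by lra.
  destruct (Rle_dec 0 c); nra.
- assert ((2 * w - c) * (2 * w + c) = 0) by lra; split; nra.
Qed.

Lemma sqrt_omega_gap : c ^ 2 / 4 < omega -> 0 < 2 * sqrt omega - c.
Proof.
intros H; destruct sqrt_omega_bounds as [Hp _]; assert (Hw2 := sqrt_omega_sqr).
set (w := sqrt omega) in *.
assert (0 < (2 * w - c) * (2 * w + c)) by lra; nra.
Qed.

Lemma Phi_hyperbolic_pulse (l : R) : c ^ 2 / 4 < omega ->
  exists v, pulse (omega - c ^ 2 / 4) c l (Phi omega c) v.
Proof.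
intros H.
assert (Hw := sqrt_omega_pos); assert (Hw2 := sqrt_omega_sqr).
assert (Hgap := sqrt_omega_gap H).
set (w := sqrt omega) in *; set (k := sqrt (4 * omega - c ^ 2)).
assert (Hk : 0 < k) by (apply sqrt_lt_R0; lra).
assert (Hk2 : k ^ 2 = 4 * omega - c ^ 2) by (apply pow2_sqrt; lra).
set (D := fun x => w * cosh (k * x) - c / 2).
assert (HD : forall x, D 0 <= D x).
{ intros x; unfold D; rewrite Rmult_0_r, cosh_0.
  generalize (cosh_ge_1 (k * x)); nra. }
assert (HD0 : 0 < D 0) by (unfold D; rewrite Rmult_0_r, cosh_0; lra).
assert (HDp : forall x, 0 < D x) by (intros x; generalize (HD x); lra).
assert (HDd : forall x, is_derive D x (w * (k * sinh (k * x)))).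
{ intros x; unfold D, cosh, sinh; auto_derive; [trivial|field]. }
assert (Hsd : forall x, is_derive (fun x => sinh (k * x)) x (k * cosh (k * x))).
{ intros x; unfold cosh, sinh; auto_derive; [trivial|field]. }
assert (Hu : forall x, Phi omega c x = sqrt (k ^ 2 / D x)).
{ intros x; unfold Phi; destruct (Rlt_dec (c ^ 2 / 4) omega) as [_|n]; [|contradiction].
  fold k w; rewrite <- Hk2; f_equal; f_equal; unfold D; field; lra. }
exists (fun x => Phi omega c x * (- (k * w * sinh (k * x)) / D x / 2)).
split.
- exists 0; split; [apply Rle_refl|].
  apply (sqrt_orbit _ _ _ (fun x => k ^ 2 / D x) (fun x => - (k * w * sinh (k * x)) / D x)
    (fun x => - (k ^ 2 * w * (cosh (k * x) * D x - w * sinh (k * x) ^ 2)) / D x ^ 2)).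
  + exact Hu.
  + intros x; apply Rdiv_lt_0_compat; [now apply pow_lt|apply HDp].
  + intros x; specialize (HDp x); evar_last.
    * apply (is_derive_div (fun _ => k ^ 2) D).
      -- apply (is_derive_const (V := R_NormedModule)).
      -- apply HDd.
      -- lra.
    * unfold zero; simpl; field; lra.
  + intros x; specialize (HDp x); evar_last.
    * apply (is_derive_div (fun x => - (k * w * sinh (k * x))) D).
      -- apply (is_derive_opp (V := R_NormedModule)).
         apply (is_derive_scal (fun x => sinh (k * x)) x (k * w)), Hsd.
      -- apply HDd.
      -- lra.
    * unfold opp; simpl; field; lra.
  + intros x; specialize (HDp x).
    replace ((- (k * w * sinh (k * x)) / D x) ^ 2)
      with (k ^ 2 * w ^ 2 * sinh (k * x) ^ 2 / D x ^ 2) by (field; lra).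
    rewrite sinh_sqr; rewrite Hk2.
    rewrite <- Hw2; unfold D in *; set (C := cosh (k * x)) in *; clearbody C; field; lra.
  + intros x; specialize (HDp x).
    replace ((- (k * w * sinh (k * x)) / D x) ^ 2)
      with (k ^ 2 * w ^ 2 * sinh (k * x) ^ 2 / D x ^ 2) by (field; lra).
    rewrite sinh_sqr; rewrite Hk2.
    rewrite <- Hw2; unfold D in *; set (C := cosh (k * x)) in *; clearbody C; field; lra.
  + intros x; unfold D; now rewrite Ropp_mult_distr_r_reverse, cosh_opp.
  + intros x; unfold D; rewrite Ropp_mult_distr_r_reverse, cosh_opp, sinh_opp.
    unfold Rdiv; ring.
- intros x; rewrite !Hu; apply sqrt_le_1_alt, Rmult_le_compat_l; [apply pow2_ge_0|].
  now apply Rinv_le_contravar.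
- intros x Hx.
  assert (Hs : 0 <= sinh (k * x)) by (apply sinh_ge_0, Rmult_le_pos; lra).
  assert (0 <= Phi omega c x) by (rewrite Hu; apply sqrt_pos).
  assert (0 <= k * w * sinh (k * x) / D x).
  { apply Rmult_le_pos; [apply Rmult_le_pos; [nra|exact Hs]|].
    apply Rlt_le, Rinv_0_lt_compat, HDp. }
  unfold Rdiv in *; nra.
Qed.

Lemma Phi_rational_pulse (l : R) : omega = c ^ 2 / 4 -> 0 < c ->
  exists v, pulse (omega - c ^ 2 / 4) c l (Phi omega c) v.
Proof.
intros Ho Hc.
set (D := fun x => (c * x) ^ 2 + 1).
assert (HDp : forall x, 0 < D x) by (intros x; unfold D; generalize (pow2_ge_0 (c * x)); lra).
assert (HDd : forall x, is_derive D x (2 * c ^ 2 * x)).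
{ intros x; unfold D; auto_derive; [trivial|ring]. }
assert (Hu : forall x, Phi omega c x = sqrt (4 * c / D x)).
{ intros x; unfold Phi; destruct (Rlt_dec (c ^ 2 / 4) omega) as [n|_]; [lra|reflexivity]. }
exists (fun x => Phi omega c x * (- (2 * c ^ 2 * x) / D x / 2)).
split.
- exists 0; split; [apply Rle_refl|].
  apply (sqrt_orbit _ _ _ (fun x => 4 * c / D x) (fun x => - (2 * c ^ 2 * x) / D x)
    (fun x => - (2 * c ^ 2 * D x - (2 * c ^ 2 * x) ^ 2) / D x ^ 2)).
  + exact Hu.
  + intros x; apply Rdiv_lt_0_compat; [lra|apply HDp].
  + intros x; specialize (HDp x); evar_last.
    * apply (is_derive_div (fun _ => 4 * c) D).
      -- apply (is_derive_const (V := R_NormedModule)).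
      -- apply HDd.
      -- lra.
    * unfold zero; simpl; field; lra.
  + intros x; specialize (HDp x); unfold D in *; auto_derive; [lra|field; lra].
  + intros x; specialize (HDp x); rewrite Ho; unfold D in *; field; lra.
  + intros x; specialize (HDp x); rewrite Ho; unfold D in *; field; lra.
  + intros x; unfold D; do 2 f_equal; ring.
  + intros x; unfold D; replace ((c * - x) ^ 2) with ((c * x) ^ 2) by ring.
    unfold Rdiv; ring.
- intros x; rewrite !Hu; apply sqrt_le_1_alt, Rmult_le_compat_l; [lra|].
  apply Rinv_le_contravar; [apply HDp|]; unfold D; generalize (pow2_ge_0 (c * x)); lra.
- intros x Hx.
  assert (0 <= Phi omega c x) by (rewrite Hu; apply sqrt_pos).
  assert (0 <= 2 * c ^ 2 * x / D x).
  { apply Rmult_le_pos; [nra|]; apply Rlt_le, Rinv_0_lt_compat, HDp. }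
  unfold Rdiv in *; nra.
Qed.

(** In the hyperbolic case the factor [2 sqrt omega - c] of [4 omega - c^2] cancels against the
    denominator at 0. *)
Lemma Phi_0 : Phi omega c 0 = sqrt (alpha1 omega c).
Proof.
assert (Hw := sqrt_omega_pos); assert (Hw2 := sqrt_omega_sqr).
unfold Phi, alpha1; destruct Rlt_dec as [H|H].
- assert (Hgap := sqrt_omega_gap H).
  rewrite Rmult_0_r, cosh_0; set (w := sqrt omega) in *; rewrite <- Hw2.
  f_equal; field; split; lra.
- destruct Hoc as [H'|[Ho Hc]]; [contradiction|].
  destruct sqrt_omega_bounds.
  replace (sqrt omega) with (c / 2) by nra.
  f_equal; field.
Qed.

Lemma Phi_small (e : R) : 0 < e -> exists x, 0 <= x /\ Phi omega c x < e.
Proof.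
intros He.
assert (Hw := sqrt_omega_pos); assert (Hw2 := sqrt_omega_sqr).
assert (He2 : 0 < e ^ 2) by now apply pow_lt.
unfold Phi; destruct Rlt_dec as [H|H].
- set (w := sqrt omega) in *; set (k := sqrt (4 * omega - c ^ 2)).
  assert (Hk : 0 < k) by (apply sqrt_lt_R0; lra).
  assert (Hk2 : k ^ 2 = 4 * omega - c ^ 2) by (apply pow2_sqrt; lra).
  assert (Hwk : 0 < w * k) by now apply Rmult_lt_0_compat.
  assert (Hq : 0 < k ^ 2 / e ^ 2) by (apply Rdiv_lt_0_compat; [apply pow_lt|]; lra).
  (* Solved from the linear bound [cosh y >= y / 2]: the denominator must exceed [k^2 / e^2], and
     [Rabs c + 1] absorbs the term [c / 2]. *)
  set (x := 2 * (k ^ 2 / e ^ 2 + Rabs c + 1) / (w * k)).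
  assert (Hx : w * (k * x / 2) = k ^ 2 / e ^ 2 + Rabs c + 1) by (unfold x; field; lra).
  assert (Hc := Rle_abs c); assert (Hc' := Rabs_pos c).
  exists x; split.
  + apply Rlt_le, Rdiv_lt_0_compat; lra.
  + rewrite <- Hk2, <- (sqrt_pow2 e) by lra.
    apply sqrt_lt_1_alt.
    assert (HD : k ^ 2 / e ^ 2 < w * (cosh (k * x) - c / (2 * w))).
    { replace (w * (cosh (k * x) - c / (2 * w))) with (w * cosh (k * x) - c / 2) by (field; lra).
      assert (w * (k * x / 2) <= w * cosh (k * x)).
      { apply Rmult_le_compat_l; [lra|apply cosh_ge_half]. }
      lra. }
    split; [apply Rlt_le, Rdiv_lt_0_compat; [apply pow_lt|]; lra|].
    apply Rmult_lt_reg_r with (w * (cosh (k * x) - c / (2 * w))); [lra|].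
    unfold Rdiv at 1; rewrite Rmult_assoc, Rinv_l by lra.
    apply Rmult_lt_compat_l with (r := e ^ 2) in HD; [|exact He2].
    replace (e ^ 2 * (k ^ 2 / e ^ 2)) with (k ^ 2) in HD by (field; lra); lra.
- destruct Hoc as [H'|[Ho Hc]]; [contradiction|].
  (* With [y = c x] the squared profile is [e^2 y / (y^2 + 1)], which is below [e^2]. *)
  exists (4 / e ^ 2); split; [apply Rlt_le, Rdiv_lt_0_compat; lra|].
  rewrite <- (sqrt_pow2 e) at 2 by lra; apply sqrt_lt_1_alt.
  set (y := c * (4 / e ^ 2)).
  assert (Hy : 4 * c = e ^ 2 * y) by (unfold y; field; lra).
  assert (Hy2 := pow2_ge_0 y).
  split; [apply Rlt_le, Rdiv_lt_0_compat; lra|].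
  apply Rmult_lt_reg_r with (y ^ 2 + 1); [lra|].
  unfold Rdiv; rewrite Rmult_assoc, Rinv_l by lra.
  rewrite Rmult_1_r, Hy; apply Rmult_lt_compat_l; [exact He2|].
  generalize (pow2_ge_0 (y - 1)); lra.
Qed.

(** Puts the velocity in a canonical form, so that it becomes a function of the parameter [L]
    without choosing witnesses. *)
Lemma pulse_Derive (a l : R) (u v : R -> R) :
  pulse a c l u v -> pulse a c l u (Derive u).
Proof.
intros H; replace (Derive u) with v; trivial.
apply functional_extensionality; intros x; symmetry.
apply is_derive_unique, (pulse_du _ _ _ _ _ x H).
Qed.

Lemma Phi_pulse (l : R) : pulse (omega - c ^ 2 / 4) c l (Phi omega c) (Derive (Phi omega c)).
Proof.
destruct Hoc as [H|[H H']].
- destruct (Phi_hyperbolic_pulse l H) as [v Hv]; exact (pulse_Derive _ _ _ _ Hv).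
- destruct (Phi_rational_pulse l H H') as [v Hv]; exact (pulse_Derive _ _ _ _ Hv).
Qed.

(** * The roots [eta1], [eta2] on the admissible interval *)

Lemma alpha0_pos : 0 < alpha0 omega c.
Proof.
assert (Hw := sqrt_omega_pos); assert (Hw2 := sqrt_omega_sqr).
destruct sqrt_omega_bounds as [Hp Hm].
unfold alpha0; set (s := sqrt (48 * omega + 4 * c ^ 2)).
assert (Hs : 0 <= s) by apply sqrt_pos.
assert (Hs2 : s ^ 2 = 48 * omega + 4 * c ^ 2)
  by (apply pow2_sqrt; generalize (pow2_ge_0 c) omega_pos; lra).
assert (H : 0 < 4 * c + s); [|lra].
set (w := sqrt omega) in *.
apply Rnot_le_lt; intros Hn.
assert (s ^ 2 <= (- (4 * c)) ^ 2) by (apply pow_incr; lra).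
nra.
Qed.

Lemma alpha0_lt_alpha1 : alpha0 omega c < alpha1 omega c.
Proof.
assert (Hw := sqrt_omega_pos); assert (Hw2 := sqrt_omega_sqr).
destruct sqrt_omega_bounds as [Hp Hm].
unfold alpha0, alpha1; set (s := sqrt (48 * omega + 4 * c ^ 2)).
assert (Hs2 : s ^ 2 = 48 * omega + 4 * c ^ 2)
  by (apply pow2_sqrt; generalize (pow2_ge_0 c) omega_pos; lra).
set (w := sqrt omega) in *.
assert (H : s < 12 * w + 2 * c); [|lra].
apply Rnot_le_lt; intros Hn.
assert ((12 * w + 2 * c) ^ 2 <= s ^ 2) by (apply pow_incr; lra).
nra.
Qed.

(** This is the discriminant formula: [eta1] and [eta2] have sum [4 c - e], so the last product is
    [- eta1 eta2], in a form showing that it vanishes at [alpha1]. *)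
Lemma polyA_eta (e : R) :
  polyA omega c e = (4 * c - e) ^ 2 + 4 * ((alpha1 omega c - e) * (e + 4 * sqrt omega - 2 * c)).
Proof. unfold polyA, alpha1; rewrite <- sqrt_omega_sqr at 1; ring. Qed.

Lemma eta_product_pos (e : R) : alpha0 omega c < e < alpha1 omega c ->
  0 < (alpha1 omega c - e) * (e + 4 * sqrt omega - 2 * c).
Proof.
intros He; generalize alpha0_pos sqrt_omega_bounds; intros H0 [_ Hm].
apply Rmult_lt_0_compat; lra.
Qed.

Lemma eta_product (e : R) : alpha0 omega c < e < alpha1 omega c ->
  eta1 omega c e * eta2 omega c e = - ((alpha1 omega c - e) * (e + 4 * sqrt omega - 2 * c)).
Proof.
intros He; assert (Hp := eta_product_pos e He); assert (HA := polyA_eta e).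
assert (H2 : sqrt (polyA omega c e) ^ 2 = polyA omega c e).
{ apply pow2_sqrt; generalize (pow2_ge_0 (4 * c - e)); lra. }
rewrite HA in H2 at 2; unfold eta1, eta2; lra.
Qed.

(** The signs follow from the negative product. The bound [eta2 < e] means [t < 3 e - 4 c]; squared,
    it is [3 e^2 - 8 c e + 4 c^2 - 16 omega > 0], whose larger root is [alpha0]. *)
Lemma eta_order (e : R) : alpha0 omega c < e < alpha1 omega c ->
  eta1 omega c e < 0 /\ 0 < eta2 omega c e /\ eta2 omega c e < e.
Proof.
intros He; assert (Hp := eta_product_pos e He); assert (HA := polyA_eta e).
assert (HAp : 0 < polyA omega c e) by (generalize (pow2_ge_0 (4 * c - e)); lra).
assert (H2 : sqrt (polyA omega c e) ^ 2 = polyA omega c e) by (apply pow2_sqrt; lra).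
assert (Ht := sqrt_lt_R0 _ HAp).
unfold eta1, eta2; set (t := sqrt (polyA omega c e)) in *.
assert (Hlt : (4 * c - e) ^ 2 < t ^ 2) by lra.
assert (Habs : - t < 4 * c - e < t) by (split; nra).
split; [lra|]; split; [lra|].
destruct He as [He _]; unfold alpha0 in He; set (s := sqrt (48 * omega + 4 * c ^ 2)) in *.
assert (Hs : 0 <= s) by apply sqrt_pos.
assert (Hs2 : s ^ 2 = 48 * omega + 4 * c ^ 2)
  by (apply pow2_sqrt; generalize (pow2_ge_0 c) omega_pos; lra).
assert (Hse : s ^ 2 < (3 * e - 4 * c) ^ 2) by nra.
unfold polyA in H2.
assert (Ht2 : t ^ 2 < (3 * e - 4 * c) ^ 2) by lra.
assert (t < 3 * e - 4 * c) by nra; lra.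
Qed.

Definition PhiE (e : R) : R -> R :=
  elliptic_profile e (modk2 omega c e) (beta2 omega c e) (gfun omega c e).

Lemma eta_sum (e : R) : eta1 omega c e + eta2 omega c e = 4 * c - e.
Proof. unfold eta1, eta2; field. Qed.

(** The symmetric functions of degree one and two of the roots are [4 c] and [4 c^2 - 16 omega]
    whatever [e] is: all these waves solve one equation, that of the soliton, and only the energy
    varies. *)
Lemma PhiE_pulse (e : R) : alpha0 omega c < e < alpha1 omega c ->
  pulse (omega - c ^ 2 / 4) c (Tper omega c e / 2) (PhiE e) (Derive (PhiE e)).
Proof.
intros He; destruct (eta_order e He) as [H1 [H2 H3]].
assert (Hp := eta_product e He); assert (Hs := eta_sum e).
destruct (elliptic_pulse (eta1 omega c e) (eta2 omega c e) e (modk2 omega c e)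
  (beta2 omega c e) (gfun omega c e) H1 H2 H3 eq_refl eq_refl eq_refl) as [v Hv].
fold (PhiE e) in Hv.
replace (2 * gfun omega c e * ellK (modk2 omega c e)) with (Tper omega c e / 2) in Hv
  by (unfold Tper; field).
replace ((eta1 omega c e + eta2 omega c e + e) / 4) with c in Hv by lra.
replace (- (eta1 omega c e * eta2 omega c e + eta1 omega c e * e + eta2 omega c e * e) / 16)
  with (omega - c ^ 2 / 4) in Hv.
- exact (pulse_Derive _ _ _ _ Hv).
- replace (eta1 omega c e * eta2 omega c e + eta1 omega c e * e + eta2 omega c e * e)
    with (eta1 omega c e * eta2 omega c e + (eta1 omega c e + eta2 omega c e) * e) by ring.
  rewrite Hp, Hs; unfold alpha1; rewrite <- (sqrt_omega_sqr) at 1; field.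
Qed.

Lemma PhiE_0 (e : R) : alpha0 omega c < e < alpha1 omega c -> PhiE e 0 = sqrt e.
Proof.
intros He; destruct (eta_order e He) as [H1 [H2 H3]].
exact (elliptic_profile_0 _ _ _ _ _ _ H1 H2 H3 eq_refl).
Qed.

Lemma PhiE_half_period (e : R) : alpha0 omega c < e < alpha1 omega c ->
  PhiE e (Tper omega c e / 2) = sqrt (eta2 omega c e).
Proof.
intros He; destruct (eta_order e He) as [H1 [H2 H3]].
replace (Tper omega c e / 2) with (2 * gfun omega c e * ellK (modk2 omega c e))
  by (unfold Tper; field).
exact (elliptic_profile_half_period _ _ _ _ _ _ H1 H2 H3 eq_refl eq_refl eq_refl).
Qed.

Lemma gfun_pos (e : R) : alpha0 omega c < e < alpha1 omega c -> 0 < gfun omega c e.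
Proof.
intros He; destruct (eta_order e He) as [H1 [H2 H3]].
exact (elliptic_g_pos _ _ _ _ H1 H2 H3 eq_refl).
Qed.

Lemma modk2_bounds (e : R) : alpha0 omega c < e < alpha1 omega c -> 0 < modk2 omega c e < 1.
Proof.
intros He; destruct (eta_order e He) as [H1 [H2 H3]]; split.
- unfold modk2; apply Rdiv_lt_0_compat; apply Rmult_lt_0_compat; lra.
- apply (elliptic_modulus _ _ _ _ H1 H2 H3 eq_refl).
Qed.

Lemma Tper_pos (e : R) : alpha0 omega c < e < alpha1 omega c -> 0 < Tper omega c e.
Proof.
intros He; unfold Tper.
assert (H1 := ellF_expands (modk2 omega c e) 0 (PI / 2)).
rewrite ellF_0 in H1; fold (ellK (modk2 omega c e)) in H1.
assert (H2 := modk2_bounds e He); assert (H3 := gfun_pos e He); assert (H4 := PI_RGT_0).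
apply Rmult_lt_0_compat; lra.
Qed.

(* [K <= pi / (2 k')] and [g^2 / k'^2 = 4 / (eta2 (eta3 - eta1))], with [k'^2 = 1 - k^2]. *)
Lemma Tper_le (e : R) : alpha0 omega c < e < alpha1 omega c ->
  Tper omega c e ^ 2 * (alpha1 omega c - e) <= 16 * PI ^ 2 / alpha0 omega c.
Proof.
intros He; destruct (eta_order e He) as [H1 [H2 H3]].
assert (Ha0 := alpha0_pos).
assert (Hk := modk2_bounds e He); assert (Hg := gfun_pos e He).
assert (Hg2 := elliptic_g_sqr _ _ _ _ H1 H2 H3 (eq_refl (gfun omega c e))).
assert (Hk' := elliptic_complementary_modulus _ _ _ _ H1 H2 H3 (eq_refl (modk2 omega c e))).
assert (HK := ellK_le (modk2 omega c e)).
assert (HK0 : 0 <= ellK (modk2 omega c e)).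
{ assert (HT := Tper_pos e He); unfold Tper in HT; nra. }
assert (Hp := eta_product e He).
set (k2 := modk2 omega c e) in *; set (g := gfun omega c e) in *.
assert (HK2 : ellK k2 ^ 2 * (1 - k2) <= PI ^ 2 / 4).
{ assert (Hs : 0 < sqrt (1 - k2)) by (apply sqrt_lt_R0; lra).
  rewrite <- (pow2_sqrt (1 - k2)), <- Rpow_mult_distr by lra.
  replace (PI ^ 2 / 4) with ((PI / 2) ^ 2) by field.
  apply pow_incr; split; [apply Rmult_le_pos; lra|]; apply HK; lra. }
set (x1 := eta1 omega c e) in *; set (x2 := eta2 omega c e) in *.
assert (HT : Tper omega c e ^ 2 * (x2 * (e - x1)) <= 16 * PI ^ 2).
{ unfold Tper; fold k2 g.
  replace ((4 * g * ellK k2) ^ 2 * (x2 * (e - x1)))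
    with (16 * (g ^ 2 * ellK k2 ^ 2 * (x2 * (e - x1)))) by ring.
  rewrite Hg2.
  replace (4 / (e * (x2 - x1)) * ellK k2 ^ 2 * (x2 * (e - x1)))
    with (4 * (ellK k2 ^ 2 * (1 - k2))) by (rewrite Hk'; field; lra).
  lra. }
apply Rmult_le_reg_r with (alpha0 omega c); [exact Ha0|].
replace (16 * PI ^ 2 / alpha0 omega c * alpha0 omega c) with (16 * PI ^ 2) by (field; lra).
eapply Rle_trans; [|exact HT].
rewrite Rmult_assoc; apply Rmult_le_compat_l; [apply pow2_ge_0|].
destruct sqrt_omega_bounds as [_ Hm].
(* The middle term is [- eta1 eta2]: at most [eta2 (e - eta1)], and at least [(alpha1 - e) alpha0]
   since [2 sqrt omega >= c]. *)
apply Rle_trans with ((alpha1 omega c - e) * (e + 4 * sqrt omega - 2 * c)).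
- apply Rmult_le_compat_l; lra.
- replace ((alpha1 omega c - e) * (e + 4 * sqrt omega - 2 * c)) with (- x1 * x2) by lra; nra.
Qed.

Lemma eta2_continuous (e : R) : continuous (eta2 omega c) e.
Proof.
assert (HA : continuous (fun e => sqrt (polyA omega c e)) e).
{ apply (continuous_comp (polyA omega c) sqrt); [|apply continuous_sqrt].
  apply (ex_derive_continuous (polyA omega c)); unfold polyA; auto_derive; trivial. }
unfold eta2, Rdiv.
apply (continuous_mult (fun e => - e + 4 * c + sqrt (polyA omega c e)) (fun _ => / 2));
  [|apply continuous_const].
apply (continuous_plus (fun e => - e + 4 * c) (fun e => sqrt (polyA omega c e))); trivial.
apply (ex_derive_continuous (fun e => - e + 4 * c)); auto_derive; trivial.
Qed.

Lemma eta2_alpha1 : eta2 omega c (alpha1 omega c) = 0.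
Proof.
destruct sqrt_omega_bounds as [_ Hm].
unfold eta2; rewrite polyA_eta, Rminus_diag, Rmult_0_l, Rmult_0_r, Rplus_0_r.
unfold alpha1.
replace ((4 * c - (4 * sqrt omega + 2 * c)) ^ 2) with ((4 * sqrt omega - 2 * c) ^ 2) by ring.
rewrite sqrt_pow2 by lra; field.
Qed.

(* If the period stayed bounded as [e] tends to [alpha1], the minimum [sqrt eta2] of the
   periodic wave would be close to a value of [Phi] on a fixed interval; but it tends to [0]. *)
Lemma Tper_unbounded (e0 B : R) : e0 < alpha1 omega c -> 0 <= B ->
  exists e, e0 < e /\ alpha0 omega c < e < alpha1 omega c /\ B < Tper omega c e.
Proof.
intros He0 HB.
assert (Ha : 0 <= omega - c ^ 2 / 4) by lra.
assert (Ha0 := alpha0_pos); assert (Ha1 := alpha0_lt_alpha1).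
destruct (pulse_gap_growth (omega - c ^ 2 / 4) c (sqrt (alpha1 omega c)) Ha (sqrt_pos _))
  as [K [HK Hgrow]].
set (X := exp (K * (B / 2))).
assert (HX : 1 <= X).
{ unfold X; assert (H := exp_ineq1_le (K * (B / 2))).
  assert (0 <= K * (B / 2)) by (apply Rmult_le_pos; lra); lra. }
set (m := Phi omega c (B / 2)).
assert (Hm : 0 < m) by exact (pulse_pos _ _ _ _ _ _ (Phi_pulse 0)).
(* By Gronwall, a period at most [B] would bound the soliton at the half period by trough plus
   amplified peak distance, that is by [h e]; but it is at least [m] there, and [h] vanishes at
   [alpha1]. *)
set (h := fun e => sqrt (eta2 omega c e) + X * (sqrt (alpha1 omega c) - sqrt e)).
assert (Hh : continuous h (alpha1 omega c)).
{ apply (continuous_plus (fun e => sqrt (eta2 omega c e))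
    (fun e => X * (sqrt (alpha1 omega c) - sqrt e))).
  - apply (continuous_comp (eta2 omega c) sqrt); [apply eta2_continuous|apply continuous_sqrt].
  - apply (continuous_scal_r (V := R_NormedModule) X (fun e => sqrt (alpha1 omega c) - sqrt e)).
    apply (continuous_minus (fun _ => sqrt (alpha1 omega c)) sqrt).
    + apply continuous_const.
    + apply continuous_sqrt. }
assert (Hh0 : h (alpha1 omega c) = 0) by (unfold h; rewrite eta2_alpha1, sqrt_0; ring).
apply (proj1 (filterlim_locally _ _)) with (eps := mkposreal m Hm) in Hh.
destruct Hh as [d Hd]; assert (Hdp := cond_pos d).
set (e := Rmax (Rmax e0 (alpha0 omega c)) (alpha1 omega c - d) / 2 + alpha1 omega c / 2).
assert (Hmax : Rmax (Rmax e0 (alpha0 omega c)) (alpha1 omega c - d) < alpha1 omega c).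
{ repeat apply Rmax_lub_lt; lra. }
assert (He1 : e0 < e).
{ assert (e0 <= Rmax (Rmax e0 (alpha0 omega c)) (alpha1 omega c - d))
    by (eapply Rle_trans; [apply Rmax_l|apply Rmax_l]).
  unfold e; lra. }
assert (He2 : alpha0 omega c < e).
{ assert (alpha0 omega c <= Rmax (Rmax e0 (alpha0 omega c)) (alpha1 omega c - d))
    by (eapply Rle_trans; [apply Rmax_r|apply Rmax_l]).
  unfold e; lra. }
assert (He3 : alpha1 omega c - d < e).
{ assert (alpha1 omega c - d <= Rmax (Rmax e0 (alpha0 omega c)) (alpha1 omega c - d))
    by apply Rmax_r.
  unfold e; lra. }
assert (He4 : e < alpha1 omega c) by (unfold e; lra).
clearbody e.
assert (He : alpha0 omega c < e < alpha1 omega c) by lra.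
exists e; split; [exact He1|]; split; [exact He|].
apply Rnot_le_lt; intros HT.
assert (Hhe : h e < m).
{ assert (Hb : ball (alpha1 omega c) d e).
  { change (Rabs (e - alpha1 omega c) < d); apply Rabs_def1; lra. }
  specialize (Hd e Hb); change (Rabs (h e - h (alpha1 omega c)) < m) in Hd.
  rewrite Hh0, Rminus_0_r in Hd; apply Rle_lt_trans with (2 := Hd), Rle_abs. }
assert (HTp := Tper_pos e He).
assert (Hse : sqrt e <= sqrt (alpha1 omega c)) by (apply sqrt_le_1_alt; lra).
assert (HG : gap (PhiE e) (Derive (PhiE e)) (Phi omega c) (Derive (Phi omega c)) (Tper omega c e / 2)
  <= (PhiE e 0 - Phi omega c 0) ^ 2 * exp (K * (Tper omega c e / 2))).
{ apply (Hgrow (Tper omega c e / 2)).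
  - now apply PhiE_pulse.
  - apply Phi_pulse.
  - now rewrite PhiE_0.
  - rewrite Phi_0; apply Rle_refl.
  - lra. }
rewrite PhiE_0, Phi_0 in HG by exact He.
unfold gap in HG; rewrite PhiE_half_period in HG by exact He.
assert (HP : m <= Phi omega c (Tper omega c e / 2)).
{ apply (pulse_antitone _ _ _ _ _ _ _ (Phi_pulse (B / 2))); lra. }
assert (HE : exp (K * (Tper omega c e / 2)) <= X).
{ apply exp_le_compat, Rmult_le_compat_l; lra. }
set (p := sqrt (alpha1 omega c) - sqrt e) in *.
unfold h in Hhe; fold p in Hhe.
set (s := sqrt (eta2 omega c e)) in *.
assert (Hs : 0 <= s) by apply sqrt_pos.
set (y := Phi omega c (Tper omega c e / 2)) in *.
assert (Hle : (y - s) ^ 2 <= (X * p) ^ 2).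
{ apply Rle_trans with (p ^ 2 * exp (K * (Tper omega c e / 2))).
  - replace ((y - s) ^ 2) with ((s - y) ^ 2) by ring.
    replace (p ^ 2) with ((sqrt e - sqrt (alpha1 omega c)) ^ 2) by (unfold p; ring).
    match type of HG with _ + ?z ^ 2 <= _ => generalize (pow2_ge_0 z) end; lra.
  - rewrite Rpow_mult_distr, Rmult_comm; apply Rmult_le_compat_r; [apply pow2_ge_0|].
    nra. }
assert (0 <= X * p) by (apply Rmult_le_pos; unfold p; lra).
nra.
Qed.

Lemma Tper_continuous (e : R) : alpha0 omega c < e < alpha1 omega c ->
  continuous (Tper omega c) e.
Proof.
intros He; destruct (eta_order e He) as [H1 [H2 H3]].
assert (Hk := modk2_bounds e He).
assert (HA : 0 < polyA omega c e).
{ rewrite polyA_eta; generalize (eta_product_pos e He) (pow2_ge_0 (4 * c - e)); lra. }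
assert (HS := sqrt_lt_R0 _ HA).
assert (Hd : eta2 omega c e - eta1 omega c e = sqrt (polyA omega c e))
  by (unfold eta1, eta2; field).
assert (Hd1 : ex_derive (eta1 omega c) e).
{ unfold eta1, polyA; unfold polyA in HA; auto_derive; repeat split; simpl in HA; lra. }
assert (Hd2 : ex_derive (eta2 omega c) e).
{ unfold eta2, polyA; unfold polyA in HA; auto_derive; repeat split; simpl in HA; lra. }
assert (Hp : 0 < e * (eta2 omega c e - eta1 omega c e)) by (apply Rmult_lt_0_compat; lra).
assert (Hp' := sqrt_lt_R0 _ Hp).
assert (Hg : continuous (gfun omega c) e).
{ apply (ex_derive_continuous (gfun omega c)); unfold gfun; auto_derive.
  change (eta2 omega c e + - eta1 omega c e) with (eta2 omega c e - eta1 omega c e).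
  repeat (split; trivial); lra. }
assert (Hm : continuous (modk2 omega c) e).
{ apply (ex_derive_continuous (modk2 omega c)); unfold modk2; auto_derive.
  change (eta2 omega c e + - eta1 omega c e) with (eta2 omega c e - eta1 omega c e).
  repeat (split; trivial); lra. }
unfold Tper.
apply (continuous_mult (fun e => 4 * gfun omega c e) (fun e => ellK (modk2 omega c e))).
- now apply (continuous_scal_r (V := R_NormedModule) 4 (gfun omega c)).
- apply (continuous_comp (modk2 omega c) ellK); [exact Hm|now apply ellK_continuous].
Qed.

(** * Selection of [eta3] and its limit *)

Lemma eta3_of_spec : exists l0, 0 < l0 /\ forall L, l0 < L ->
  alpha0 omega c < eta3_of omega c L < alpha1 omega c /\ Tper omega c (eta3_of omega c L) = 2 * L.
Proof.
assert (Ha1 := alpha0_lt_alpha1).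
set (e0 := (alpha0 omega c + alpha1 omega c) / 2).
assert (He0 : alpha0 omega c < e0 < alpha1 omega c) by (unfold e0; lra).
assert (HT0 := Tper_pos e0 He0).
(* As the period is positive, [L > Tper e0] gives [2 L > Tper e0]. The value [2 L] is then crossed
   between [e0] and a point nearer [alpha1] with a longer period. *)
exists (Tper omega c e0); split; [exact HT0|].
intros L HL; unfold eta3_of; apply epsilon_spec.
assert (H2L : 0 <= 2 * L) by lra.
destruct (Tper_unbounded e0 (2 * L) (proj2 He0) H2L) as [e1 [H01 [He1 HT1]]].
destruct (IVT_interv (fun e => Tper omega c e - 2 * L) e0 e1) as [e [Hee HTe]]; try lra.
- intros t Ht; apply continuity_pt_filterlim.
  apply (continuous_minus (Tper omega c) (fun _ => 2 * L)); [|apply continuous_const].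
  apply Tper_continuous; lra.
- exists e; split; lra.
Qed.

Lemma eta3_of_lim : is_lim (eta3_of omega c) p_infty (alpha1 omega c).
Proof.
destruct eta3_of_spec as [l0 [Hl0 Hspec]].
assert (Ha0 := alpha0_pos).
(* Inserting [Tper = 2 L] in [Tper_le] gives [alpha1 - eta3 <= C / L^2], weakened to [C / L] for
   [L > 1]. *)
set (C := 4 * PI ^ 2 / alpha0 omega c).
apply (is_lim_le_le_loc (fun L => alpha1 omega c - C / L) (fun _ => alpha1 omega c)).
- exists (Rmax 1 l0); intros L HL.
  assert (H1 : 1 < L) by (eapply Rle_lt_trans; [apply Rmax_l|exact HL]).
  assert (H2 : l0 < L) by (eapply Rle_lt_trans; [apply Rmax_r|exact HL]).
  destruct (Hspec L H2) as [He HT]; split; [|lra].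
  assert (HB := Tper_le _ He); rewrite HT in HB.
  assert (HC : L ^ 2 * (alpha1 omega c - eta3_of omega c L) <= C).
  { unfold C; apply Rmult_le_reg_l with 4; [lra|].
    replace (4 * (4 * PI ^ 2 / alpha0 omega c)) with (16 * PI ^ 2 / alpha0 omega c)
      by (field; lra).
    lra. }
  assert (H3 : alpha1 omega c - eta3_of omega c L <= C / L); [|lra].
  apply Rmult_le_reg_r with L; [lra|].
  unfold Rdiv; rewrite Rmult_assoc, Rinv_l by lra.
  assert (0 <= L * (L - 1) * (alpha1 omega c - eta3_of omega c L))
    by (repeat apply Rmult_le_pos; lra).
  lra.
- replace (Finite (alpha1 omega c)) with (Finite (alpha1 omega c - 0)) by (f_equal; ring).
  apply (is_lim_minus' (fun _ => alpha1 omega c) (fun L => C / L)); [apply is_lim_const|].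
  replace (Finite 0) with (Rbar_mult C 0) by (simpl; f_equal; ring).
  apply (is_lim_scal_l Rinv C p_infty 0).
  apply (is_lim_inv (fun L => L) p_infty p_infty); [apply is_lim_id|discriminate].
- apply is_lim_const.
Qed.

Lemma PhiL_Hm_lim (m : nat) :
  is_lim (fun L => Hm_norm m L (fun x => PhiL omega c L x - Phi omega c x)) p_infty 0.
Proof.
destruct eta3_of_spec as [l0 [Hl0 Hspec]].
apply (pulse_Hm_lim (omega - c ^ 2 / 4) c l0 (fun L => PhiE (eta3_of omega c L))
  (fun L => Derive (PhiE (eta3_of omega c L))) (Phi omega c) (Derive (Phi omega c))).
- lra.
- intros L HL; destruct (Hspec L HL) as [He HT].
  (* Only the length of the pulse is rewritten: [L] is exactly the half period on which the wave
     decreases. *)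
  replace L with (Tper omega c (eta3_of omega c L) / 2) at 1 by lra.
  now apply PhiE_pulse.
- exact Phi_pulse.
- rewrite Phi_0.
  apply (is_lim_ext_loc (fun L => sqrt (eta3_of omega c L))).
  + exists l0; intros L HL; symmetry; apply PhiE_0, Hspec, HL.
  + apply (is_lim_comp_continuous (eta3_of omega c) sqrt p_infty (alpha1 omega c)).
    * exact eta3_of_lim.
    * apply continuous_sqrt.
- exact Phi_small.
Qed.

End Soliton.

Theorem theorem1p2 (omega c : R)
  (Hoc : c ^ 2 / 4 < omega \/ (omega = c ^ 2 / 4 /\ 0 < c))
  (m : nat) :
  is_lim (fun L => Hm_norm m L (fun x => PhiL omega c L x - Phi omega c x))
         p_infty 0.
Proof. exact (PhiL_Hm_lim omega c Hoc m). Qed.
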